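(* Let $X$ be a nondegenerate random variable in $\mathbb{R}^d$ and let $\varphi_X(u)=\mathbb{E}[e^{\mathrm{i}\langle u,X\rangle}]$ denote its characteristic function. Then there exist a linear subspace $V\subset\mathbb{R}^d$, a nonsingular matrix $T\in\mathbb{R}^{d\times d}$, and integers $0\le\nu\le r\le d$ and $q\ge1$ with the following properties. (1) $\pi_V(X)$ is lattice, and $|\varphi_X(2\pi v)|<1$ for every $v\in\mathbb{R}^d\setminus V$. (2) $|\varphi_{TX}(2\pi u)|=1\iff u\in\mathbb{Z}^r\times\{0\}$, where $0$ is the zero vector in $\mathbb{R}^{d-r}$. (3) Let $TX=(Y,Z)$ with $Y\in\mathbb{R}^r$ and $Z\in\mathbb{R}^{d-r}$. Then $\mathbb{P}\{Y\in\beta+\mathbb{Z}^r\}=1$ for some $\beta=(0,\ldots,0,\beta_\nu,\ldots,\beta_r)$, where $\beta_\nu=p/q\in\mathbb{Q}$ with $0\le p<q$ coprime, and $\beta_{\nu+1},\ldots,\beta_r\in(0,1)\setminus\mathbb{Q}$ are rationally independent. Furthermore, $V$, $r$, $\nu$ and $q$ with properties (1), (2) and (3) are unique, and $r=\dim(V)$.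
   Context: A random variable in $\mathbb{R}^d$ is nondegenerate if it is not concentrated in any affine subspace of dimension $d-1$. $\pi_V$ is the orthogonal projection onto $V$. A random variable is lattice if it is concentrated on $a+\Gamma$ for some $a\in\mathbb{R}^d$ and some lattice $\Gamma\subset\mathbb{R}^d$, a lattice being an additive subgroup of $\mathbb{R}^d$ with no cluster points. Two integers are coprime if their greatest common divisor is $1$ (so $p=0$ forces $q=1$). Real numbers $c_1,\ldots,c_n$ are rationally independent if for $m_1,\ldots,m_n\in\mathbb{Z}$, $\sum m_ic_i\in\mathbb{Z}\iff$ all $m_i=0$. Convention: if $\nu=0$ there is no entry $\beta_\nu$, i.e. $\beta=(\beta_1,\ldots,\beta_r)$, and $q=1$ ($p=0$). *)

(* Defs.v *)
From HB Require Import structures.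
From mathcomp Require Import all_boot all_order all_algebra.
From mathcomp Require Import complex.
From mathcomp Require Import all_classical all_reals all_analysis.
Set Implicit Arguments.
Unset Strict Implicit.
Unset Printing Implicit Defensive.
Import Order.TTheory GRing.Theory Num.Theory.
Import numFieldNormedType.Exports.
Local Open Scope classical_set_scope.
Local Open Scope ring_scope.

(* R^d is 'cV[R]_d; [borelRd R d] is the same type with its Borel sigma-algebra. *)
Definition borelRd (R : realType) (d : nat) : measurableType _ :=
  g_sigma_algebraType (@open 'cV[R]_d).

Section euclidean.
Context {R : realType}.

Definition dotv (d : nat) (u v : 'cV[R]_d) : R := \sum_i u i 0 * v i 0.

Definition is_orthoproj (d : nat) (V : {vspace 'cV[R]_d}) (x p : 'cV[R]_d) :=
  p \in V /\ forall v, v \in V -> dotv (x - p) v = 0.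

(* The choice is harmless: see [orthoprojP] and [orthoproj_unique]. *)
Definition orthoproj (d : nat) (V : {vspace 'cV[R]_d}) (x : 'cV[R]_d) :
  'cV[R]_d := xget 0 [set p | is_orthoproj V x p].

Lemma dotvDl (d : nat) (u v w : 'cV[R]_d) :
  dotv (u + v) w = dotv u w + dotv v w.
Proof.
by rewrite -big_split; apply: eq_bigr => i _; rewrite mxE mulrDl.
Qed.

Lemma dotvNl (d : nat) (u w : 'cV[R]_d) : dotv (- u) w = - dotv u w.
Proof.
by rewrite -sumrN; apply: eq_bigr => i _; rewrite mxE mulNr.
Qed.

Lemma dotv_eq0 (d : nat) (u : 'cV[R]_d) : dotv u u = 0 -> u = 0.
Proof.
move=> u0; apply/colP => i; rewrite mxE.
have ge0 j : true -> 0 <= u j 0 * u j 0 by move=> _; rewrite -expr2 sqr_ge0.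
have /allP/(_ i (mem_index_enum i)) : all (fun j => true ==> (u j 0 * u j 0 == 0))
    (index_enum 'I_d) by rewrite -psumr_eq0 //; apply/eqP.
by rewrite /= mulf_eq0 orbb => /eqP.
Qed.

Lemma orthoproj_unique (d : nat) (V : {vspace 'cV[R]_d}) (x p q : 'cV[R]_d) :
  is_orthoproj V x p -> is_orthoproj V x q -> p = q.
Proof.
move=> [pV xp] [qV xq]; apply/eqP; rewrite -subr_eq0; apply/eqP/dotv_eq0.
have VB : p - q \in V by rewrite rpredB.
have {1}-> : p - q = (x - q) - (x - p) by rewrite opprB [RHS]addrC subrKA.
by rewrite dotvDl dotvNl xp // xq // subr0.
Qed.

Lemma orthoproj_exists (d : nat) (V : {vspace 'cV[R]_d}) (x : 'cV[R]_d) :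
  exists p, is_orthoproj V x p.
Proof.
pose b := vbasis V.
pose B : 'M[R]_(\dim V, d) := \matrix_(i, j) (tnth b i) j 0.
pose G := B *m B^T.
have BTE (y : 'cV[R]_(\dim V)) : B^T *m y = \sum_i y i 0 *: tnth b i.
  apply/colP => j; rewrite mxE summxE; apply: eq_bigr => i _.
  by rewrite !mxE mulrC.
have Guv (u v : 'cV[R]_(\dim V)) :
    dotv (B^T *m u) (B^T *m v) = (u^T *m G *m v) 0 0.
  rewrite /G mulmxA -[B in u^T *m B]trmxK -trmx_mul -mulmxA mxE.
  by apply: eq_bigr => i _; rewrite [X in _ = X * _]mxE.
have Gunit : G \in unitmx.
  rewrite -row_free_unit -kermx_eq0; apply/eqP/row_matrixP => i; rewrite row0.
  set y := row i _.
  have yG : y *m G = 0 by apply/sub_kermxP; rewrite row_sub.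
  have : B^T *m y^T = 0.
    by apply: dotv_eq0; rewrite Guv trmxK yG mul0mx mxE.
  rewrite BTE => fb; apply/rowP => k; rewrite [RHS]mxE.
  have /freeP/(_ (fun i => y^T i 0)) := basis_free (vbasisP V).
  rewrite -/b => /(_ _ k); rewrite mxE; apply.
  by rewrite -[RHS]fb; apply: eq_bigr => j _; rewrite -tnth_nth.
pose y := invmx G *m (B *m x).
exists (B^T *m y); split.
  rewrite BTE; apply: rpred_sum => i _; apply: rpredZ.
  by apply: vbasis_mem; exact: mem_tnth.
move=> v /coord_vbasis ->.
have -> : \sum_i coord b i v *: b`_i = B^T *m (\col_i coord b i v).
  by rewrite BTE; apply: eq_bigr => i _; rewrite mxE -tnth_nth.
set c := \col__ _.
suff : ((B *m (x - B^T *m y))^T *m c) 0 0 = 0.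
  rewrite trmx_mul -mulmxA mxE => <-.
  by apply: eq_bigr => i _; rewrite [X in _ = X * _]mxE.
by rewrite mulmxBr !mulmxA -/G mulmxV // mul1mx subrr trmx0 mul0mx mxE.
Qed.

Lemma orthoprojP (d : nat) (V : {vspace 'cV[R]_d}) (x : 'cV[R]_d) :
  is_orthoproj V x (orthoproj V x).
Proof.
have [p Hp] := orthoproj_exists V x.
by rewrite /orthoproj; case: xgetP => [y _ //|/(_ p)].
Qed.

Definition is_lattice (d : nat) (G : set 'cV[R]_d) :=
  [/\ G 0, (forall x y, G x -> G y -> G (x - y)) & limit_point G = set0].

Definition Zvec (r : nat) : set 'cV[R]_r :=
  [set m | forall i, m i 0 \is a Num.int].

(* The R^r-component of R^d = R^r x R^(d - r). *)
Definition head_part (d r : nat) (hr : (r <= d)%N) (x : 'cV[R]_d) : 'cV[R]_r :=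
  rowsub (widen_ord hr) x.

(* Z^r x {0} as a subset of R^d. *)
Definition Zvec0 (d r : nat) (hr : (r <= d)%N) : set 'cV[R]_d :=
  [set u | Zvec (head_part hr u) /\ forall i : 'I_d, (r <= i)%N -> u i 0 = 0].

Definition rationally_independent (I : finType) (c : I -> R) :=
  forall m : I -> int,
    \sum_i (m i)%:~R * c i \is a Num.int <-> forall i, m i = 0.

(* Coordinates are numbered from 0 here: beta i 0 is the (i + 1)-st entry. *)
Definition canonical_shift (r nu q : nat) (beta : 'cV[R]_r) :=
  exists p : nat,
    [/\ (p < q)%N, coprime p q, (nu = 0%N -> q = 1%N),
        (forall i : 'I_r, (i.+1 < nu)%N -> beta i 0 = 0)
      & (forall i : 'I_r, i.+1 = nu -> beta i 0 = p%:R / q%:R)] /\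
    [/\ (forall i : 'I_r, (nu < i.+1)%N -> 0 < beta i 0 < 1),
        (forall i : 'I_r, (nu < i.+1)%N -> irrational (beta i 0))
      & rationally_independent
          (fun i : {i : 'I_r | (nu < i.+1)%N} => beta (val i) 0)].

End euclidean.

Section random_vectors.
Context {disp : measure_display} {Omega : measurableType disp} {R : realType}.
Variable P : probability Omega R.

Definition concentrated_on (d : nat) (X : Omega -> 'cV[R]_d)
  (A : set 'cV[R]_d) := P (X @^-1` A) = 1%E.

Definition nondegenerate_rv (d : nat) (X : Omega -> 'cV[R]_d) :=
  forall (a : 'cV[R]_d) (W : {vspace 'cV[R]_d}), (\dim W).+1 = d ->
    ~ concentrated_on X [set a + w | w in [set` W]].

Definition lattice_rv (d : nat) (X : Omega -> 'cV[R]_d) :=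
  exists a (G : set 'cV[R]_d),
    is_lattice G /\ concentrated_on X [set a + g | g in G].

(* E[exp(i<u, X>)], integrating real and imaginary parts separately. *)
Definition charfun (d : nat) (X : Omega -> 'cV[R]_d) (u : 'cV[R]_d) : R[i] :=
  ((\int[P]_w cos (dotv u (X w))) +i* (\int[P]_w sin (dotv u (X w))))%C.

Definition lattice_part (d : nat) (X : Omega -> 'cV[R]_d)
    (V : {vspace 'cV[R]_d}) :=
  lattice_rv (fun w => orthoproj V (X w)) /\
  forall v, v \notin V -> `|charfun X ((2 * pi) *: v)| < 1.

Definition unit_modulus_on_Zvec0 (d : nat) (X : Omega -> 'cV[R]_d)
    (T : 'M[R]_d) (r : nat) (hr : (r <= d)%N) :=
  forall u : 'cV[R]_d,
    `|charfun (fun w => T *m X w) ((2 * pi) *: u)| = 1 <-> Zvec0 hr u.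

Definition canonical_support (d : nat) (X : Omega -> 'cV[R]_d) (T : 'M[R]_d)
    (r : nat) (hr : (r <= d)%N) (nu q : nat) :=
  exists beta : 'cV[R]_r,
    canonical_shift nu q beta /\
    concentrated_on (fun w => head_part hr (T *m X w))
      [set beta + m | m in @Zvec R r].

Definition lattice_normal_form (d : nat) (X : Omega -> 'cV[R]_d)
    (V : {vspace 'cV[R]_d}) (T : 'M[R]_d) (nu r q : nat) :=
  exists hr : (r <= d)%N,
    [/\ T \in unitmx, (nu <= r)%N & (1 <= q)%N] /\
    [/\ lattice_part X V, unit_modulus_on_Zvec0 X T hr
      & canonical_support X T hr nu q].

End random_vectors.

(* Main.v *)
Require Import Defs.
From mathcomp Require Import all_boot all_order all_algebra.
From mathcomp Require Import complex.
From mathcomp Require Import all_classical all_reals all_analysis.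
From mathcomp Require Import measurable_realfun ring lra.
Set Implicit Arguments.
Unset Strict Implicit.
Unset Printing Implicit Defensive.
Import Order.TTheory GRing.Theory Num.Theory.
Import numFieldNormedType.Exports.
Local Open Scope classical_set_scope.
Local Open Scope ring_scope.

(** Everything is read off the set H of frequencies of X: the vectors u such
    that <u, X> almost surely lies in one coset c + Z.

    These are exactly the u with |phi(2 pi u)| = 1 ([charfun_modulus]). Indeed,
    if a + ib denotes the value of the characteristic function, then
    E[(cos - a)^2 + (sin - b)^2] = 1 - (a^2 + b^2), so that the modulus is at
    most one, and equals one only if cosine and sine are almost surely constant.

    H is a subgroup, and nondegeneracy makes it discrete
    ([frequency_separated]): for small u in H, <u, X> is almost surely constant on
    an event {|X| <= N} on which X is already nondegenerate. A discrete subgroup of R^d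
    has an integral basis which is free over R ([subgroup_zbasis]); let r be
    its size and V its span. In the coordinates of this basis, X lies in a
    shifted copy beta + Z^r. With this basis completed to an invertible matrix T,
    the u at which |phi_TX(2 pi u)| = 1 are the vectors of Z^r x {0}; and the dual
    basis, projected to V, generates a lattice supporting the projection of X.

    The basis can still be changed by GL_r(Z), and this brings beta to
    canonical form ([canonical_shift_exists]). The relations m with <m, beta>
    in Z form a sublattice of Z^r, which the Smith normal form diagonalises
    with divisors d_1 | d_2 | ...; its quotient embeds in the group R/Z, whose
    finite subgroups are cyclic, so among the nonzero d_i only the last one can
    differ from a unit. This last one, if there is any, is q up to sign; the
    number of nonzero ones is nu, and the coordinates with d_i = 0 are rationally independent.

    For uniqueness, each of the four data is described by X alone
    ([normal_form_invariants]). V is the span of H: by assumption no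
    frequency lies outside V, and the dual of a lattice supporting the projection
    of X to V projects into H and, by nondegeneracy, onto a spanning set of V
    ([lattice_part_sub]). The rank of H is r. Call u in H torsion if
    N <u, X> is almost surely an integer for some N > 0. The torsion frequencies
    form a group of rank nu, and q generates the ideal of the N which work for
    all of them. *)

(** * Integral bases of discrete subgroups *)

Section lattices.
Context {R : realType}.

Definition colspan d n (B : 'M[R]_(d, n)) : {vspace 'cV[R]_d} :=
  limg (linfun (mulmx B) : 'Hom('cV[R]_n, 'cV[R]_d)).

Definition colfree d n (B : 'M[R]_(d, n)) := forall y : 'cV[R]_n, B *m y = 0 -> y = 0.

Lemma colspanP d n (B : 'M[R]_(d, n)) v :
  reflect (exists y, v = B *m y) (v \in colspan B).
Proof.
apply: (iffP memv_imgP) => [[y _ ->]|[y ->]]; exists y; rewrite ?lfunE //.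
exact: memvf.
Qed.

Lemma dim_colspan d n (B : 'M[R]_(d, n)) : colfree B -> \dim (colspan B) = n.
Proof.
move=> Bfree; rewrite limg_dim_eq.
  by rewrite dimvf /dim /= muln1.
apply/eqP; rewrite -subv0; apply/subvP => y; rewrite memv_cap memv_ker lfunE /=.
by move=> /andP[_ /eqP/Bfree->]; rewrite mem0v.
Qed.

Lemma dim_cV d (V : {vspace 'cV[R]_d}) : (\dim V <= d)%N.
Proof.
by apply: leq_trans (dimvS (subvf V)) _; rewrite dimvf /dim /= muln1.
Qed.

Lemma col_colspan d n (B : 'M[R]_(d, n)) j : col j B \in colspan B.
Proof. by apply/colspanP; exists (delta_mx j 0); rewrite colE. Qed.

Lemma colspan_sub d n (B : 'M[R]_(d, n)) (W : {vspace 'cV[R]_d}) :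
  (forall j, col j B \in W) -> (colspan B <= W)%VS.
Proof.
move=> BW; apply/subvP => _ /colspanP[y ->].
have -> : B *m y = \sum_j y j 0 *: col j B.
  apply/colP => i; rewrite summxE mxE; apply: eq_bigr => j _.
  by rewrite !mxE mulrC.
by apply: rpred_sum => j _; apply: rpredZ.
Qed.

Lemma colfree_row_mx d n (x : 'cV[R]_d) (B : 'M[R]_(d, n)) :
  colfree B -> x \notin colspan B -> colfree (row_mx x B).
Proof.
move=> Bfree xB y; rewrite -[y]vsubmxK; set a := usubmx y; set z := dsubmx y.
have {}yE (c : R) : a = c%:M -> row_mx x B *m col_mx a z = c *: x + B *m z.
  by move=> ->; rewrite mul_row_col mul_mx_scalar.
have aE := mx11_scalar a; rewrite (yE _ aE) => /eqP; rewrite addr_eq0 => /eqP Ex.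
have a0 : a 0 0 = 0.
  apply/eqP; apply: contraNT xB => a0; apply/colspanP.
  exists (- (a 0 0)^-1 *: z); rewrite -scalemxAr scaleNr -scalerN -Ex.
  by rewrite scalerA mulVf // scale1r.
move: Ex; rewrite a0 scale0r => /esym/eqP; rewrite oppr_eq0 => /eqP/Bfree ->.
by rewrite aE a0 raddf0 col_mx0.
Qed.

(** Serves twice: to start the construction of an integral basis of a discrete
    group, and to see that a linearly closed set is a subspace. *)
Lemma max_colfree d (S : set 'cV[R]_d) :
  exists n (B : 'M[R]_(d, n)),
    [/\ colfree B, forall j, S (col j B) & forall x, S x -> x \in colspan B].
Proof.
pose good n := `[< exists B : 'M[R]_(d, n), colfree B /\ forall j, S (col j B) >].
have good0 : exists n, good n.
  by exists 0%N; apply/asboolP; exists 0; split=> [y _|[]//]; rewrite [y]flatmx0.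
have good_le n : good n -> (n <= d)%N.
  by move=> /asboolP[B [Bf _]]; rewrite -(dim_colspan Bf); exact: dim_cV.
case: (ex_maxnP good0 good_le) => n /asboolP[B [Bfree SB]] nmax.
exists n, B; split=> // x Sx; apply/negPn/negP => xB.
suff /nmax : good n.+1 by rewrite ltnn.
apply/asboolP; exists (row_mx x B : 'M[R]_(d, 1 + n)); split.
  exact: colfree_row_mx.
move=> j; change (S (@col R d (1 + n) j (row_mx x B))).
case: (@split_ordP 1 n j) => i ->.
  by rewrite colKl; suff -> : col i x = x by []; apply/colP => k; rewrite mxE ord1.
by rewrite colKr.
Qed.

Lemma colfree_row_mxE d n (x : 'cV[R]_d) (B : 'M[R]_(d, n)) :
  colfree (row_mx x B) -> colfree B /\ x \notin colspan B.
Proof.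
move=> xBfree; split=> [y By0|].
  have /(congr1 dsubmx) : col_mx 0 y = 0 :> 'cV_(1 + n).
    by apply: xBfree; rewrite mul_row_col mulmx0 By0 addr0.
  by rewrite col_mxKd raddf0.
apply/negP => /colspanP[y xE].
have /(congr1 usubmx) : col_mx 1%:M (- y) = 0 :> 'cV_(1 + n).
  by apply: xBfree; rewrite mul_row_col mulmx1 mulmxN xE subrr.
rewrite col_mxKu raddf0 => /matrixP/(_ 0 0)/eqP.
by rewrite !mxE /= oner_eq0.
Qed.

Definition subgroup_set d (G : set 'cV[R]_d) :=
  G 0 /\ forall x y, G x -> G y -> G (x - y).

(** For a subgroup, this is the absence of cluster points in the form in which
    it is used: no nonzero element is close to the origin. *)
Definition separated_set d (G : set 'cV[R]_d) :=
  exists2 e : R, 0 < e & forall x, G x -> (forall i, `|x i 0| < e) -> x = 0.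

(** Freeness over R, and not only over Z, makes the size and the real span of the
    basis invariants of G. *)
Definition zbasis d n (G : set 'cV[R]_d) (B : 'M[R]_(d, n)) :=
  colfree B /\
  forall u, G u <-> exists m : 'cV[int]_n, u = B *m map_mx intr m.

Lemma subgroup_setD d (G : set 'cV[R]_d) x y :
  subgroup_set G -> G x -> G y -> G (x + y).
Proof.
move=> [G0 GB] Gx Gy; rewrite -[y]opprK; apply: (GB) => //.
by rewrite -[- y]add0r; apply: GB.
Qed.

Lemma subgroup_setZ d (G : set 'cV[R]_d) (m : int) x :
  subgroup_set G -> G x -> G (m%:~R *: x).
Proof.
move=> sG Gx; have GM (n : nat) : G (n%:R *: x).
  elim: n => [|n IH]; first by rewrite scale0r; case: sG.
  by rewrite -natr1 scalerDl scale1r; apply: subgroup_setD.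
case: (intP m) => [|n|n]; first by rewrite scale0r; case: sG.
  exact: GM.
by rewrite mulrNz scaleNr -sub0r; apply: sG.2; [case: sG|apply: GM].
Qed.

(** Pigeonhole: two elements of G in the same cell of a grid of side e differ
    by an element of G which is smaller than e, hence by zero. *)
Lemma bounded_finite d (G : set 'cV[R]_d) (C : R) :
  subgroup_set G -> separated_set G ->
  finite_set [set x | G x /\ forall i, `|x i 0| <= C].
Proof.
move=> [_ GB] [e e0 Ge]; set F := [set x | _].
pose N := Num.truncn ((C + C) / e).
pose f (x : 'cV[R]_d) : {ffun 'I_d -> 'I_N.+1} :=
  [ffun i => inord (Num.truncn ((x i 0 + C) / e))].
have f_inj : {in F &, injective f}.
  move=> x y /[!inE] -[Gx xC] [Gy yC] /ffunP fE; apply/eqP; rewrite -subr_eq0.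
  apply/eqP; apply: Ge => [|i]; first exact: GB.
  have bd (z : 'cV[R]_d) : (forall i, `|z i 0| <= C) ->
      [/\ 0 <= (z i 0 + C) / e & (Num.truncn ((z i 0 + C) / e)%R < N.+1)%N].
    move=> /(_ i); rewrite ler_norml => /andP[Cz zC]; split.
      by rewrite divr_ge0 ?(ltW e0) // -[C]opprK subr_ge0.
    by rewrite ltnS /N le_truncn // ler_wpM2r ?invr_ge0 ?(ltW e0) // lerD2r.
  have [x0 xN] := bd _ xC; have [y0 yN] := bd _ yC.
  have /(congr1 val) := fE i; rewrite !ffunE /= !inordK // => E.
  have /andP[] := truncn_itv x0; have /andP[] := truncn_itv y0; rewrite -E.
  move: (Num.truncn _) => k.
  rewrite !ler_pdivlMr // !ltr_pdivrMr // -natr1 mulrDl mul1r !mxE ltr_norml.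
  by move=> *; apply/andP; split; lra.
rewrite -(eq_finite_set (inj_card_eq f_inj)).
exact: finite_finset.
Qed.

Lemma finite_set_min (A : set R) a : finite_set A -> A a ->
  exists2 t, A t & forall s, A s -> t <= s.
Proof.
move=> /finite_seqP[s ->] /= {A}; elim: s a => [//|b s IH] a.
have [->|/eqP s0] := eqVneq s [::].
  by move=> _; exists b => [|c] /=; rewrite ?mem_head // mem_seq1 => /eqP ->.
case: s s0 IH => [//|c s] _ /(_ c (mem_head _ _))[t ts tmin] _.
have [bt|tb] := leP b t.
  exists b => [|u]; first exact: mem_head.
  by rewrite /= inE => /predU1P[-> //|/tmin]; exact: le_trans.
exists t => [|u]; first by rewrite /= inE ts orbT.
by rewrite /= inE => /predU1P[->|/tmin //]; exact: ltW.
Qed.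

Lemma zbasis_sub d n (G : set 'cV[R]_d) (B : 'M[R]_(d, n)) (W : {vspace _}) :
  zbasis G B -> (colspan B <= W)%VS <-> (forall x, G x -> x \in W).
Proof.
move=> [_ GB]; split=> [/subvP BW x /GB[m ->]|GW].
  by apply: BW; apply/colspanP; exists (map_mx intr m).
apply: colspan_sub => j; apply: GW; apply/GB; exists (delta_mx j 0).
by rewrite map_delta_mx colE.
Qed.

Lemma mulmx_bound m n (B : 'M[R]_(m, n)) (y : 'cV[R]_n) i :
  (forall j, `|y j 0| <= 1) -> `|(B *m y) i 0| <= \sum_k \sum_j `|B k j|.
Proof.
move=> y1; apply: le_trans (_ : \sum_j `|B i j| <= _).
  rewrite mxE; apply: le_trans (ler_norm_sum _ _ _) _; apply: ler_sum => j _.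
  by rewrite normrM ler_piMr.
rewrite [leRHS](bigD1 i) //= lerDl; apply: sumr_ge0 => k _.
exact: sumr_ge0.
Qed.

(** Induction on the number of columns x, B0 of B. Let B1 be an integral basis
    of the part of G in the span of B0. Among the elements t x + z of G with
    t > 0 and z in this span, one has the least t: modulo B1 those with t <= 1
    can be taken bounded, so that only finitely many t occur. This element
    g0 completes B1, because by division with remainder every element of G is
    a multiple of g0 plus an element with coefficient 0 at x. *)
Lemma subgroup_zbasis_colspan d (G : set 'cV[R]_d) n (B : 'M[R]_(d, n)) :
  subgroup_set G -> separated_set G -> colfree B -> (forall j, G (col j B)) ->
  exists B' : 'M[R]_(d, n), zbasis [set x | G x /\ x \in colspan B] B'.
Proof.
move=> sG sepG; elim: n B => [|n IH] B Bfree GB.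
  exists 0; split=> [y _|u]; first by rewrite [y]flatmx0.
  split=> [[_ /colspanP[y ->]]|[m ->]].
    by exists 0; rewrite [y]flatmx0 mulmx0 mul0mx.
  by rewrite mul0mx; split; [case: sG|rewrite mem0v].
pose x : 'cV[R]_d := lsubmx (B : 'M[R]_(d, 1 + n)).
pose B0 : 'M[R]_(d, n) := rsubmx (B : 'M[R]_(d, 1 + n)).
have BE : B = row_mx x B0 by rewrite hsubmxK.
have /colfree_row_mxE[B0free xB0] : colfree (row_mx x B0) by rewrite -BE.
have GB' (j : 'I_(1 + n)) : G (col j (row_mx x B0)) by rewrite -BE.
have Gx : G x.
  by have := GB' (lshift n 0); rewrite colKl; congr G; apply/colP => k; rewrite mxE.
have [|B1 B1b] := IH B0 B0free.
  by move=> j; have := GB' (rshift 1 j); rewrite colKr.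
have B10 : colspan B1 = colspan B0.
  apply/eqP; rewrite eqEdim !dim_colspan ?leqnn ?andbT //; last by case: B1b.
  by apply/(zbasis_sub _ B1b) => y [].
rewrite -B10 in xB0 B1b.
have GB1 m : G (B1 *m map_mx intr m).
  by have [] := (B1b.2 (B1 *m map_mx intr m)).2 (ex_intro _ m erefl).
have spanE u : u \in colspan B <-> exists s z, u = s *: x + z /\ z \in colspan B1.
  rewrite BE; split=> [/colspanP[y ->]|[s [z [-> ]]]].
    rewrite -[y](@vsubmxK _ 1 n 1) (mul_row_col x B0) [usubmx _]mx11_scalar mul_mx_scalar.
    by do 2 eexists; split; first reflexivity; rewrite B10; apply/colspanP; eexists.
  rewrite B10 => /colspanP[y ->]; apply/colspanP.
  by exists (col_mx s%:M y); rewrite (mul_row_col x B0) mul_mx_scalar.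
have xN a : a != 0 -> a *: x \in colspan B1 -> x \in colspan B1.
  by move=> /negPf a0; rewrite rpredZeq a0.
have uniq_coef s s' z z' : z \in colspan B1 -> z' \in colspan B1 ->
    s *: x + z = s' *: x + z' -> s = s'.
  move=> zB zB' /eqP; rewrite -subr_eq0 opprD addrACA -scalerBl addr_eq0 => /eqP E.
  apply/eqP; rewrite -subr_eq0; apply: contraNT xB0 => ss.
  by apply: xN ss _; rewrite E rpredN rpredB.
pose C : R := \sum_k \sum_j `|(row_mx x B1 : 'M[R]_(d, 1 + n)) k j|.
have bdC s (y : 'cV[R]_n) (i : 'I_d) : 0 <= s <= 1 -> (forall j, 0 <= y j 0 <= 1) ->
    `|(s *: x + B1 *m y) i 0| <= C.
  move=> /andP[s0 s1] y1.
  have -> : s *: x + B1 *m y = row_mx x B1 *m col_mx s%:M y.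
    by rewrite mul_row_col mul_mx_scalar.
  apply: mulmx_bound => j; case: (split_ordP j) => k ->.
    by rewrite col_mxEu ord1 mxE eqxx mulr1n ger0_norm.
  by rewrite col_mxEd; have /andP[? ?] := y1 k; rewrite ger0_norm.
pose F := [set u | G u /\ forall i, `|u i 0| <= C].
(* The bound C holds for t in [0, 1] once z is reduced modulo B1. *)
pose A := [set t | 0 < t /\ exists2 z, z \in colspan B1 & F (t *: x + z)].
(* As x is not in the span of B1, the coefficient t is a function of t x + z. *)
pose h u := xget 0 [set t | exists2 z, z \in colspan B1 & u = t *: x + z].
have finA : finite_set A.
  apply: (@sub_finite_set _ _ (h @` F)); last first.
    by apply: finite_image; exact: bounded_finite.
  move=> t [t0 [z zB Ftz]]; exists (t *: x + z) => //; rewrite /h.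
  case: xgetP => [y _ [z' zB' /esym]|/(_ t)]; first exact: uniq_coef.
  by case; exists z.
have A1 : A 1.
  split=> //; exists 0; first exact: mem0v.
  split; first by rewrite addr0 scale1r.
  by move=> i; rewrite -(mulmx0 _ B1); apply: bdC => [|j]; rewrite ?mxE ?lexx ler01.
have [t [t0 [z0 z0B [Gg0 _]]] tmin] := finite_set_min finA A1.
have t1 : t <= 1 := tmin _ A1.
pose g0 := t *: x + z0.
exists (row_mx g0 B1 : 'M[R]_(d, 1 + n)); split.
  apply: colfree_row_mx; first by case: B1b.
  by apply: contra xB0 => g0B; apply: (xN t); rewrite ?lt0r_neq0 // -(addrK z0 (t *: x)) rpredB.
have mE (m : 'cV[int]_(1 + n)) : row_mx g0 B1 *m map_mx intr m =
    (usubmx m 0 0)%:~R *: g0 + B1 *m map_mx intr (dsubmx m).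
  rewrite -{1}[m]vsubmxK map_col_mx mul_row_col.
  by rewrite [map_mx _ (usubmx m)]mx11_scalar mul_mx_scalar !mxE.
move=> u; split=> [[Gu /spanE[s [z [uE zB]]]]|[m ->]]; last first.
  rewrite (mE m); set a := usubmx _ _ _.
  split; first by apply: subgroup_setD => //; apply: subgroup_setZ.
  apply/spanE; do 2 eexists; split.
    by rewrite /g0 scalerDr scalerA -addrA; reflexivity.
  by rewrite rpredD ?rpredZ //; apply/colspanP; eexists.
pose m := Num.floor (s / t).
pose s' := s - m%:~R * t.
have /colspanP[y yE] : z - m%:~R *: z0 \in colspan B1 by rewrite rpredB ?rpredZ.
have uE' : u - m%:~R *: g0 = s' *: x + B1 *m y.
  by rewrite -yE uE /g0 /s' scalerDr opprD addrACA scalerBl scalerA.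
have Gu' : G (s' *: x + B1 *m y) by rewrite -uE'; apply: sG.2 => //; exact: subgroup_setZ.
have /andP[ms sm] := floor_itv (s / t).
have s'0 : 0 <= s' by rewrite subr_ge0 -ler_pdivlMr.
have s't : s' < t.
  rewrite -/m intrD ltr_pdivrMr // mulrDl mul1r in sm; rewrite /s'; lra.
have s'E : s' = 0.
  apply/eqP; rewrite eq_le s'0 andbT leNgt; apply/negP => s'gt.
  suff /tmin : A s' by rewrite leNgt s't.
  (* Subtracting an integer combination of B1 makes the other coordinates
     fractional, hence the whole vector bounded by C. *)
  pose fy : 'cV[int]_n := \col_j Num.floor (y j 0).
  split=> //; exists (B1 *m (y - map_mx intr fy)); first by apply/colspanP; eexists.
  split; first by rewrite mulmxBr addrA; apply: sG.2.
  move=> i; apply: bdC => [|j]; first by rewrite s'0 ltW // (lt_le_trans s't).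
  rewrite !mxE; have /andP[] := floor_itv (y j 0); rewrite intrD.
  by move=> *; apply/andP; split; lra.
rewrite s'E scale0r add0r in Gu' uE'.
have [m' m'E] : exists m', B1 *m y = B1 *m map_mx intr m'.
  by apply/B1b.2; split=> //; apply/colspanP; eexists.
exists (col_mx m%:M m'); rewrite (mE (col_mx m%:M m')) col_mxKu col_mxKd mxE eqxx.
by rewrite -m'E -uE' addrC subrK.
Qed.

Lemma subgroup_zbasis d (G : set 'cV[R]_d) :
  subgroup_set G -> separated_set G ->
  exists n (B : 'M[R]_(d, n)), zbasis G B.
Proof.
move=> sG sepG; have [n [B [Bfree GB Bmax]]] := max_colfree G.
have [B' [B'free B'E]] := subgroup_zbasis_colspan sG sepG Bfree GB.
exists n, B'; split=> // u; rewrite -B'E; split=> [Gu|[]//].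
by split=> //; exact: Bmax.
Qed.

End lattices.

(** * Discreteness, chains of subspaces, completion to a basis *)

Section discreteness.
Context {R : realType}.

(** Only the origin has to be excluded as a cluster point. *)
Lemma is_lattice_separated d (G : set 'cV[R]_d) :
  is_lattice G -> subgroup_set G /\ separated_set G.
Proof.
move=> [G0 GB Glim]; split=> //.
have : ~ limit_point G 0 by rewrite Glim.
move=> /existsNP[U /not_implyP[/nbhs_ballP[e /= e0 eU] /forallNP UG]].
exists e => // x Gx xe; apply/eqP/negP => /negP x0; apply: (UG x); split=> //.
by apply: eU; split=> // i j; rewrite ord1 /ball /= mxE sub0r normrN.
Qed.

(** Near a cluster point there would be two distinct elements of G, whose
    difference contradicts the separation. *)
Lemma separated_is_lattice d (G : set 'cV[R]_d) :
  subgroup_set G -> separated_set G -> is_lattice G.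
Proof.
move=> [G0 GB] [e e0 Ge]; split=> //; rewrite -subset0 => t Gt.
have nb (r : R) : 0 < r -> exists y, [/\ y != t, G y & forall i, `|t i 0 - y i 0| < r].
  move=> r0; have [|y [yt Gy [_ yr]]] := Gt (ball t r).
    by apply/nbhs_ballP; exists r.
  by exists y; split=> // i; exact: yr.
have [|y [yt Gy ye]] := nb (e / 2); first by rewrite divr_gt0.
have [i yi] : exists i, y i 0 != t i 0.
  apply: contrapT => /forallNP yE; move/eqP: yt; apply; apply/colP => i.
  by apply/eqP/negPn/negP; exact: yE.
have [|z [zt Gz ze]] := nb (Num.min (e / 2) `|t i 0 - y i 0|).
  by rewrite lt_min divr_gt0 //= normr_gt0 subr_eq0 eq_sym.
have /eqP : y - z = 0.
  apply: Ge => [|j]; first exact: GB.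
  have -> : (y - z) j 0 = (t j 0 - z j 0) - (t j 0 - y j 0) by rewrite !mxE; lra.
  apply: le_lt_trans (ler_normB _ _) _; rewrite [e]splitr; apply: ltrD => //.
  by have := ze j; rewrite lt_min => /andP[].
rewrite subr_eq0 => /eqP yz; have := ze i; rewrite -yz lt_min => /andP[_].
by rewrite ltxx.
Qed.

Lemma submod_vspace d (S : set 'cV[R]_d) :
  S 0 -> (forall a x y, S x -> S y -> S (a *: x + y)) ->
  exists W : {vspace 'cV[R]_d}, forall x, S x <-> x \in W.
Proof.
move=> S0 SL; have [n [B [_ SB SBmax]]] := max_colfree S.
exists (colspan B) => x; split=> [/SBmax//|/colspanP[y ->]].
have -> : B *m y = \sum_j y j 0 *: col j B.
  by apply/colP => i; rewrite summxE mxE; apply: eq_bigr => j _; rewrite !mxE mulrC.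
by apply: (big_rec (fun z => S z)) => // j z _ Sz; exact: SL.
Qed.

(** Dimensions of subspaces cannot decrease forever, so the chain reaches its
    intersection. *)
Lemma decreasing_submod d (S : nat -> set 'cV[R]_d) :
  (forall n, S n 0) ->
  (forall n a x y, S n x -> S n y -> S n (a *: x + y)) ->
  (forall n x, S n.+1 x -> S n x) ->
  (forall x, (forall n, S n x) -> x = 0) ->
  exists n, forall x, S n x -> x = 0.
Proof.
move=> S0 SL Sdec Scap.
have /choice[W SW] : forall n, exists W : {vspace 'cV[R]_d}, forall x, S n x <-> x \in W.
  by move=> n; apply: (submod_vspace (S := S n)); [exact: S0|exact: SL].
have Sle n m x : (n <= m)%N -> S m x -> S n x.
  by move=> /subnK <-; elim: (m - n)%N => // k IH; rewrite addSn => /Sdec.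
have exm : exists m, `[< exists n, \dim (W n) = m >].
  by exists (\dim (W 0%N)); apply/asboolP; exists 0%N.
case: (ex_minnP exm) => m /asboolP[n nm] mmin.
exists n => x Sx; apply: Scap => k.
have WW : (W (maxn n k) <= W n)%VS.
  by apply/subvP => y /SW Sy; apply/SW; apply: Sle Sy; exact: leq_maxl.
have /eqP WE : W (maxn n k) == W n.
  rewrite eqEdim WW nm; apply: mmin; apply/asboolP; by exists (maxn n k).
by apply: (Sle k (maxn n k)); rewrite ?leq_maxr //; apply/SW; rewrite WE; apply/SW.
Qed.

Lemma colfree_row_free d n (B : 'M[R]_(d, n)) : colfree B -> row_free B^T.
Proof.
move=> Bfree; rewrite -kermx_eq0; apply/eqP/row_matrixP => i; rewrite row0.
have /sub_kermxP uB : (row i (kermx B^T) <= kermx B^T)%MS by exact: row_sub.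
by apply: trmx_inj; rewrite trmx0; apply: Bfree; rewrite -[LHS]trmxK trmx_mul trmxK uB trmx0.
Qed.

(** In Gaussian elimination B^T = L [1 0] E, with L and E invertible; the matrix
    E, with L acting on its first r rows, completes B^T. *)
Lemma row_completion d r (hr : (r <= d)%N) (B : 'M[R]_(d, r)) : colfree B ->
  exists2 T : 'M[R]_d, T \in unitmx & rowsub (widen_ord hr) T = B^T.
Proof.
move=> /colfree_row_free.
have [k dE] : exists k, d = (r + k)%N by exists (d - r)%N; rewrite subnKC.
subst d; move: (B^T) => {}B Bfree.
exists (block_mx (col_ebase B) 0 0 1%:M *m row_ebase B).
  by rewrite unitmx_mul row_ebase_unit unitmxE det_ublock det1 mulr1 -unitmxE col_ebase_unit.
transitivity (usubmx (block_mx (col_ebase B) 0 0 1%:M *m row_ebase B)).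
  apply/matrixP => i j; rewrite !mxE; apply: eq_bigr => l _.
  by congr (fun_of_matrix _ _ _ * _); apply: val_inj.
rewrite block_mxEv mul_col_mx col_mxKu -[RHS]mulmx_ebase.
by rewrite (eqP Bfree) pid_mx_row mul_mx_row mulmx1 mulmx0.
Qed.

End discreteness.

(** * Sublattices of Z^r *)

Section smith.
Context {R : realType}.

Lemma intr_mx_inj m n : injective (map_mx intr : 'M[int]_(m, n) -> 'M[R]_(m, n)).
Proof.
by move=> A B /matrixP AB; apply/matrixP => i j; have := AB i j; rewrite !mxE => /intr_inj.
Qed.

(** The stacked basis theorem, with divisors equal to 0 in the missing
    directions. The real integral basis of L, which happens to have integer
    entries, provides the finite matrix to which the Smith normal form
    applies. *)
Lemma sublattice_smith r (L : set 'cV[int]_r) :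
  L 0 -> (forall x y, L x -> L y -> L (x - y)) ->
  exists (B : 'M[int]_r) (d : nat -> int),
    [/\ B \in unitmx, forall i, (d i %| d i.+1)%Z
      & forall m, L (B *m m) <-> forall i : 'I_r, (d i %| m i 0%R)%Z].
Proof.
move=> L0 LB.
pose G : set 'cV[R]_r := [set map_mx intr m | m in L].
have sG : subgroup_set G.
  split; first by exists 0; rewrite ?raddf0.
  by move=> _ _ [x Lx <-] [y Ly <-]; exists (x - y); rewrite ?raddfB //; exact: LB.
have sepG : separated_set G.
  exists 1; rewrite ?ltr01 // => _ [x Lx <-] x1; apply/colP => i.
  have := x1 i; rewrite !mxE -intr_norm -[1]/(1%:~R) ltr_int => xi.
  by move: xi; rewrite -[1]add0r ltzD1 normr_le0 => /eqP ->.
have [n [C [_ GC]]] := subgroup_zbasis sG sepG.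
have [M ME] : exists M : 'M[int]_(r, n), C = map_mx intr M.
  have /choice[f fE] (j : 'I_n) : exists x : 'cV[int]_r, col j C = map_mx intr x.
    have [|x _ <-] := (GC (col j C)).2; last by exists x.
    by exists (delta_mx j 0); rewrite map_delta_mx colE.
  exists (\matrix_(i, j) f j i 0); apply/matrixP => i j.
  by have /colP/(_ i) := fE j; rewrite !mxE.
have LM m : L m <-> exists y, m = M *m y.
  split=> [Lm|[y ->]].
    have [|y] := (GC (map_mx intr m)).1; first by exists m.
    by rewrite ME -map_mxM => /intr_mx_inj ->; exists y.
  have [|x Lx] := (GC (map_mx intr (M *m y))).2; first by exists y; rewrite ME map_mxM.
  by move=> /intr_mx_inj <-.
have [A Aunit [B Bunit [s s_sorted MT]]] := int_Smith_normal_form M^T.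
(* Cutting the divisors off at n is needed as s may be longer than the matrix. *)
pose d i := if (i < n)%N then s`_i else 0.
exists B^T, d; split.
- by rewrite unitmx_tr.
- move=> i; rewrite /d; case: (ltnP i.+1 n) => [i1|_]; last exact: dvdz0.
  rewrite (ltnW i1); case: (ltnP i.+1 (size s)) => [i2|i2].
    exact: (elimT (sortedP (0 : int)) s_sorted i i2).
  by rewrite (nth_default _ i2) dvdz0.
set D := \matrix_(i, j) _ in MT.
have DE (y : 'cV[int]_n) (i : 'I_r) :
    (D^T *m y) i 0 = if insub (val i) is Some j then d i * y j 0 else 0.
  rewrite mxE; case: insubP => [j jn ji|ni].
    rewrite (bigD1 j) //= big1 ?addr0 => [|k kj].
      by rewrite !mxE ji eqxx mulr1n /d jn.
    rewrite !mxE -ji; suff /negPf -> : (k != j :> nat) by rewrite mulr0n mul0r.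
    by apply: contra kj => /eqP/val_inj ->.
  rewrite big1 // => k _; rewrite !mxE; case: eqP => [ki|]; last by rewrite mulr0n mul0r.
  by move: ni; rewrite -[val i]/(nat_of_ord i) -ki ltn_ord.
have {}LM m : L (B^T *m m) <-> exists y, m = D^T *m y.
  rewrite LM -[M]trmxK MT !trmx_mul; split=> [[y yE]|[y ->]].
    exists (A^T *m y); rewrite mulmxA.
    apply: (can_inj (mulKmx (_ : B^T \in unitmx))); first by rewrite unitmx_tr.
    by rewrite yE !mulmxA.
  exists (invmx A^T *m y); rewrite -!mulmxA; congr (_ *m (_ *m _)).
  by rewrite mulmxA mulmxV ?unitmx_tr // mul1mx.
move=> m; rewrite LM; split=> [[y ->] i|dm].
  by rewrite DE; case: insub => [j|]; rewrite ?dvdz0 // dvdz_mulr.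
have /choice[f fE] (j : 'I_n) : exists c : int,
    forall i : 'I_r, val i = val j -> m i 0 = d i * c.
  have [/existsP[i /eqP ij]|/existsPn no] := boolP [exists i : 'I_r, val i == val j].
    have /dvdzP[c cE] := dm i; exists c => i' i'j.
    have -> : i' = i by apply: val_inj; rewrite i'j ij.
    by rewrite cE mulrC.
  by exists 0 => i ij; have := no i; rewrite ij eqxx.
exists (\col_j f j); apply/colP => i; rewrite DE.
case: insubP => [j jn ji|ni]; first by rewrite mxE (fE j).
by have := dm i; rewrite /d (negPf ni) dvd0z => /eqP.
Qed.

End smith.

(** * Canonical form of a shift modulo integers *)

Section canonical_shift.
Context {R : realType}.

Lemma int_frac01 (x : R) : x \is a Num.int -> 0 <= x < 1 -> x = 0.
Proof.
move=> /intrP[m ->] /andP[]; rewrite ler0z -[1]/(1%:~R) ltr_int => m0 m1.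
by have /eqP -> : m == 0 by rewrite eq_le m0 -ltzD1 add0r m1.
Qed.

Lemma rational_frac (x : R) (a D : int) : D != 0 -> D%:~R * x = a%:~R -> 0 <= x < 1 ->
  exists p q : nat, [/\ (p < q)%N, coprime p q & x = p%:R / q%:R].
Proof.
move=> D0 Dx /andP[x0 x1]; pose y : rat := a%:~R / D%:~R.
have yE : x = ratr y.
  by rewrite /y fmorph_div !rmorph_int -Dx mulrC mulKf // intr_eq0.
have y0 : 0 <= numq y by rewrite numq_ge0 -(ler0q R) -yE.
have xE : x = `|numq y|%N%:R / `|denq y|%N%:R.
  by rewrite yE -{1}[y]divq_num_den fmorph_div !rmorph_int !natr_absz !ger0_norm // ltW ?denq_gt0.
exists `|numq y|%N, `|denq y|%N; split=> //; last exact: coprime_num_den.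
have q0 : (0 < `|denq y|%N)%N by rewrite absz_gt0 denq_eq0.
by move: x1; rewrite xE ltr_pdivrMr ?ltr0n // mul1r ltr_nat.
Qed.

(** The assumption on relations says that Z^r modulo the relations of b is the
    product of the Z / d_i. As this group embeds in R/Z, whose finite subgroups
    are cyclic, its torsion part comes from a single divisor; nu is the number
    of nonzero divisors, and q is the denominator of the last rational coordinate,
    with q = 1 if there is none. *)
Lemma canonical_shift_of_divisors r (b : 'cV[R]_r) (d : nat -> int) :
  (forall i, (d i %| d i.+1)%Z) -> (forall i, 0 <= b i 0 < 1) ->
  (forall m : 'cV[int]_r, \sum_i (m i 0)%:~R * b i 0 \is a Num.int <->
    forall i : 'I_r, (d i %| m i 0%R)%Z) ->
  exists nu q : nat, [/\ (nu <= r)%N, (0 < q)%N & canonical_shift nu q b].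
Proof.
move=> dd b01 LE.
have LE1 (i : 'I_r) (c : int) : c%:~R * b i 0 \is a Num.int <-> (d i %| c)%Z.
  have -> : c%:~R * b i 0 = \sum_j ((c *: delta_mx i 0 : 'cV[int]_r) j 0)%:~R * b j 0.
    rewrite (bigD1 i) //= big1 ?addr0 => [|j ji].
      by rewrite !mxE !eqxx mulr1.
    by rewrite !mxE (negPf ji) mulr0 mul0r.
  rewrite LE; split=> [/(_ i)|dc j]; rewrite !mxE eqxx andbT ?eqxx ?mulr1 //.
  by case: eqVneq => [->|_]; rewrite ?mulr1 ?mulr0 ?dvdz0.
have dle i j : (i <= j)%N -> (d i %| d j)%Z.
  by move=> /subnK <-; elim: (j - i)%N => // k IH; rewrite addSn (dvdz_trans IH).
have exk : exists k, (k == r) || (d k == 0) by exists r; rewrite eqxx.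
case: (ex_minnP exk) => k kP kmin.
have kr : (k <= r)%N by apply: kmin; rewrite eqxx.
have dN0 i : (i < k)%N -> d i != 0.
  by move=> ik; apply: contraL ik => di; rewrite -leqNgt kmin // di orbT.
have d0 (i : 'I_r) : (k <= i)%N -> d i = 0.
  move=> ki; case/orP: kP => [/eqP kE|/eqP dk]; first by move: ki; rewrite kE leqNgt ltn_ord.
  by have := dle _ _ ki; rewrite dk dvd0z => /eqP.
(* Let j = i + 1, a = d_i b_i and c = d_j b_j, which are integers, and d_j = e d_i.
   The vector with entries c at i and - a e at j is a relation, so d_j divides
   a e, that is d_i divides a, and b_i is an integer. *)
have b0 (i : 'I_r) : (i.+1 < k)%N -> b i 0 = 0.
  move=> ik; apply: int_frac01 => //.
  have di0 := dN0 i (ltnW ik); have dj0 := dN0 _ ik.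
  have /intrP[a aE] : (d i)%:~R * b i 0 \is a Num.int by apply/LE1.
  pose j : 'I_r := Ordinal (leq_trans ik kr).
  have /dvdzP[e eE] : (d i %| d i.+1)%Z by [].
  have e0 : e != 0 by apply: contraNneq dj0 => e0; rewrite eE e0 mul0r.
  have /intrP[c cE] : (d j)%:~R * b j 0 \is a Num.int by apply/LE1.
  have /LE/(_ j) : \sum_l ((c *: delta_mx i 0 - (a * e) *: delta_mx j 0 : 'cV[int]_r) l 0)%:~R
      * b l 0 \is a Num.int.
    rewrite (bigD1 i) //= (bigD1 j) /=; last by rewrite -val_eqE /= gtn_eqF.
    rewrite big1 ?addr0 => [|l /andP[/negPf li /negPf lj]]; last first.
      by rewrite !mxE li lj !mulr0 subr0 mul0r.
    rewrite !mxE !eqxx [i == j]eq_sym -!val_eqE /= !gtn_eqF // !mulr0 !mulr1 subr0 sub0r.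
    have dE : (d j)%:~R = e%:~R * (d i)%:~R :> R by rewrite -intrM -eE.
    rewrite mulrNz mulNr intrM -aE -cE dE.
    suff -> : e%:~R * (d i)%:~R * b j 0 * b i 0 - (d i)%:~R * b i 0 * e%:~R * b j 0 = 0.
      exact: rpred0.
    by ring.
  rewrite !mxE !eqxx -!val_eqE /= gtn_eqF // mulr0 mulr1 sub0r rpredN eE [e * _]mulrC.
  rewrite dvdz_mul2r // => /dvdzP[f fE]; suff -> : b i 0 = f%:~R by exact: intr_int.
  by apply: (mulfI (_ : (d i)%:~R != 0)); rewrite ?intr_eq0 // aE fE intrM mulrC.
have irr (i : 'I_r) : (k <= i)%N -> forall N : int, N%:~R * b i 0 \is a Num.int -> N = 0.
  by move=> ki N /LE1; rewrite d0 // dvd0z => /eqP.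
have [p [q [qgt0 pq cpq q1 bE]]] : exists p q : nat,
    [/\ (0 < q)%N, (p < q)%N, coprime p q, (k = 0%N -> q = 1%N)
      & forall i : 'I_r, i.+1 = k -> b i 0 = p%:R / q%:R].
  case: (posnP k) => [k0|k_gt0].
    by exists 0%N, 1%N; split=> // i; rewrite k0.
  have ik : (k.-1 < r)%N by rewrite prednK.
  pose i := Ordinal ik.
  have di0 : d i != 0 by apply: dN0; rewrite /= prednK.
  have /intrP[a aE] : (d i)%:~R * b i 0 \is a Num.int by apply/LE1.
  have [p [q [pq cpq bE]]] := rational_frac di0 aE (b01 i).
  exists p, q; split=> //; first exact: leq_ltn_trans pq.
    by move=> k0; rewrite k0 in k_gt0.
  move=> j jk; rewrite -bE; congr (b _ _); apply: val_inj; by rewrite /= -jk.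
exists k, q; split=> //; exists p.
split; [by []|split=> [i|i|m]; rewrite ?ltnS].
- move=> ki; have /andP[bi0 ->] := b01 i; rewrite andbT lt_neqAle bi0 andbT eq_sym.
  apply/eqP => bi; suff /(irr i ki)/eqP : 1%:~R * b i 0 \is a Num.int by rewrite oner_eq0.
  by rewrite bi mulr0 rpred0.
- move=> ki [y _ yE].
  suff /(irr i ki)/eqP : (denq y)%:~R * b i 0 \is a Num.int by rewrite denq_eq0.
  rewrite -[b i 0]yE -[X in ratr X]divq_num_den fmorph_div !rmorph_int mulrC mulfVK ?intr_int //.
  by rewrite intr_eq0 denq_eq0.
pose me : 'cV[int]_r := \col_i (if insub i is Some j then m j else 0).
have meE j : me (val j) 0 = m j by rewrite mxE valK.
have -> : \sum_j (m j)%:~R * b (val j) 0 = \sum_i (me i 0)%:~R * b i 0.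
  under eq_bigr do rewrite -meE.
  rewrite -(big_sub [pred i : 'I_r | (k < i.+1)%N] (fun i => (me i 0)%:~R * b i 0)).
  rewrite [RHS](bigID [pred i : 'I_r | (k < i.+1)%N]) /= [X in _ + X]big1 ?addr0 // => i.
  by move=> /negPf ki; rewrite mxE insubF // mul0r.
rewrite LE; split=> [dm j|m0 i].
  by have := dm (val j); rewrite d0 ?dvd0z ?meE => [/eqP//|]; exact: (valP j).
by rewrite mxE; case: insub => [j|]; rewrite ?m0 dvdz0.
Qed.

(** The relation lattice of beta is diagonalised by a change of basis of Z^r;
    subtracting integer parts then leaves the relations unchanged. *)
Lemma canonical_shift_exists r (beta : 'cV[R]_r) :
  exists (U : 'M[int]_r) (n : 'cV[int]_r) (nu q : nat),
    [/\ U \in unitmx, (nu <= r)%N, (0 < q)%N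
      & canonical_shift nu q (map_mx intr U *m beta + map_mx intr n)].
Proof.
pose L : set 'cV[int]_r := [set m | \sum_i (m i 0)%:~R * beta i 0 \is a Num.int].
have [| |B [d [Bunit dd LB]]] := @sublattice_smith R r L.
- by rewrite /L /= big1 // => i _; rewrite mxE mul0r.
- move=> x y Lx Ly; rewrite /L /=.
  under eq_bigr do rewrite !mxE intrB mulrBl.
  by rewrite sumrB rpredB.
pose b1 := map_mx intr B^T *m beta.
pose n : 'cV[int]_r := \col_i - Num.floor (b1 i 0).
pose b := b1 + map_mx intr n.
have LE (m : 'cV[int]_r) :
    \sum_i (m i 0)%:~R * b i 0 \is a Num.int <-> forall i : 'I_r, (d i %| m i 0%R)%Z.
  rewrite -LB /L /=.
  have -> : \sum_i (m i 0)%:~R * b i 0 =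
      \sum_i ((B *m m) i 0)%:~R * beta i 0 + \sum_i (m i 0 * n i 0)%:~R.
    transitivity ((map_mx intr m^T *m b) 0 0).
      by rewrite mxE; apply: eq_bigr => i _; rewrite !mxE.
    rewrite mulmxDr mxE mulmxA -map_mxM -trmx_mul; congr (_ + _).
      by rewrite mxE; apply: eq_bigr => i _; rewrite !mxE.
    by rewrite mxE; apply: eq_bigr => i _; rewrite !mxE intrM.
  by rewrite rpredDr // rpred_sum // => i _; exact: intr_int.
have b01 i : 0 <= b i 0 < 1.
  have -> : b i 0 = b1 i 0 - (Num.floor (b1 i 0))%:~R.
    by rewrite /b mxE [X in _ + X]mxE [n i 0]mxE rmorphN.
  rewrite subr_ge0 ltrBlDl.
  by have /andP[-> /=] := floor_itv (b1 i 0); rewrite intrD.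
have [nu [q [nur q0 can]]] := canonical_shift_of_divisors dd b01 LE.
by exists B^T, n, nu, q; rewrite unitmx_tr.
Qed.

End canonical_shift.

(** * Characteristic functions of modulus one *)

Section characteristic_function.
Context {disp : measure_display} {Omega : measurableType disp} {R : realType}.
Context (P : probability Omega R).

Lemma cos_sin_2pi (k : int) : cos (2 * pi * k%:~R) = 1 :> R /\ sin (2 * pi * k%:~R) = 0 :> R.
Proof.
have base : cos (2 * pi) = 1 :> R /\ sin (2 * pi) = 0 :> R.
  by rewrite mulr_natl cos2pi sin2pi.
have nat_case (n : nat) : cos (2 * pi * n%:R) = 1 :> R /\ sin (2 * pi * n%:R) = 0 :> R.
  elim: n => [|n [IHc IHs]]; first by rewrite mulr0 cos0 sin0.
  by rewrite -(natr1 n) mulrDr mulr1 cosD sinD IHc IHs base.1 base.2; split; ring.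
case: (intP k) => [|n|n]; first by rewrite mulr0 cos0 sin0.
  exact: nat_case.
by rewrite mulrNz mulrN cosN sinN; have [-> ->] := nat_case n.+1; rewrite oppr0.
Qed.

(** After reduction to 0 <= x < 2 pi, the half angle y has sin y = 0 and
    0 <= y < pi, so it vanishes. *)
Lemma cos_eq1 (x : R) : cos x = 1 -> exists k : int, x = 2 * pi * k%:~R.
Proof.
have pi2 : 0 < 2 * pi :> R by rewrite mulr_gt0 // pi_gt0.
move=> cx; pose k := Num.floor (x / (2 * pi)); exists k.
have /andP[] := floor_itv (x / (2 * pi)); rewrite -/k intrD.
rewrite ler_pdivlMr // ltr_pdivrMr // mulrDl mul1r [k%:~R * _]mulrC => kx xk.
apply/eqP; rewrite eq_sym eq_le kx /= leNgt; apply/negP => {}kx.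
pose y := (x - 2 * pi * k%:~R) / 2.
have : sin y != 0.
  by rewrite gt_eqF // sin_gt0_pi // /y; apply/andP; split; lra.
have yE : y *+ 2 = x - 2 * pi * k%:~R by rewrite /y mulr2n -splitr.
have := cos_mulr2n y; rewrite yE cosB cx.
have [-> ->] := cos_sin_2pi k; rewrite mulr0 addr0 mulr1 cos2sin2 => E.
rewrite -sqrf_eq0; move: E; rewrite !mulr2n => E; suff -> : sin y ^+ 2 = 0 by rewrite eqxx.
by lra.
Qed.

Lemma prob_ae_ex (Q : Omega -> Prop) : (\forall w \ae P, Q w) -> exists w, Q w.
Proof.
move=> QP; apply: (@filter_ex _ (almost_everywhere P)) => //.
have P0 : (0 < P setT)%E by rewrite probability_setT lte01.
exact: ae_properfilter_algebraOfSetsType P0.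
Qed.

Lemma bounded_integrable (f : Omega -> R) (C : R) :
  measurable_fun setT f -> (forall w, `|f w| <= C) -> P.-integrable setT (EFin \o f).
Proof.
move=> mf fC; have P1 : (P setT < +oo)%E by rewrite probability_setT ltry.
apply: (measurable_bounded_integrable _ P1 mf) => //.
exists C; split; first exact: num_real.
by move=> M CM w _; exact: le_trans (fC w) (ltW CM).
Qed.

Lemma Rintegral_prob_cst (c : R) : \int[P]_(w in setT) c = c.
Proof.
rewrite Rintegral_cst // -[RHS]mulr1; congr (c * _).
exact: (congr1 fine (probability_setT P)).
Qed.

Lemma Rintegral_ae_cst (f : Omega -> R) (c : R) : measurable_fun setT f ->
  (\forall w \ae P, f w = c) -> \int[P]_w f w = c.
Proof.
move=> mf fc; rewrite -[RHS]Rintegral_prob_cst /Rintegral; congr fine.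
apply: ae_eq_integral => //; first exact/measurable_EFinP.
by apply: filterS fc => w /= -> _.
Qed.

Lemma Rintegral_ge0_eq0 (f : Omega -> R) : P.-integrable setT (EFin \o f) ->
  (forall w, 0 <= f w) -> \int[P]_w f w = 0 -> \forall w \ae P, f w = 0.
Proof.
move=> fi f0 intf.
have /(ae_eq_integral_abs _ measurableT (measurable_int _ fi)) fE :
    (\int[P]_w `|(f w)%:E| = 0)%E.
  under eq_integral do rewrite /= ger0_norm //.
  by rewrite -(fineK (integrable_fin_num _ fi)) // -[fine _]/(\int[P]_w f w) intf.
by apply: filterS fE => w /= /(_ I) [].
Qed.

Context (theta : Omega -> R) (mtheta : measurable_fun setT theta).

Let a := \int[P]_w cos (theta w).
Let b := \int[P]_w sin (theta w).
Let g w := (cos (theta w) - a) ^+ 2 + (sin (theta w) - b) ^+ 2.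

Let mcos : measurable_fun setT (fun w => cos (theta w)).
Proof.
by apply: measurableT_comp mtheta; apply: continuous_measurable_fun; exact: continuous_cos.
Qed.

Let msin : measurable_fun setT (fun w => sin (theta w)).
Proof.
by apply: measurableT_comp mtheta; apply: continuous_measurable_fun; exact: continuous_sin.
Qed.

(* The integrand of the variance of exp(i theta), expanded: it is affine in cosine and
   sine, so its integral is explicit. *)
Let gE w : g w = (1 + (a ^+ 2 + b ^+ 2)) + (- (2 * a) * cos (theta w) + - (2 * b) * sin (theta w)).
Proof.
have E := cos2Dsin2 (theta w).
rewrite /g; transitivity (cos (theta w) ^+ 2 + sin (theta w) ^+ 2 + (a ^+ 2 + b ^+ 2)
  + (- (2 * a) * cos (theta w) + - (2 * b) * sin (theta w))); first by ring.
by rewrite E.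
Qed.

Let icos : P.-integrable setT (EFin \o (fun w => cos (theta w))).
Proof. by apply: (@bounded_integrable _ 1) => // w; exact: cos_max. Qed.

Let isin : P.-integrable setT (EFin \o (fun w => sin (theta w))).
Proof. by apply: (@bounded_integrable _ 1) => // w; exact: sin_max. Qed.

Let iZ c (f : Omega -> R) : P.-integrable setT (EFin \o f) ->
  P.-integrable setT (EFin \o (fun w => c * f w)).
Proof. by move=> fi; apply: eq_integrable (integrableZl measurableT c fi). Qed.

Let ilin : P.-integrable setT
  (EFin \o (fun w => - (2 * a) * cos (theta w) + - (2 * b) * sin (theta w))).
Proof.
exact: eq_integrable (integrableD measurableT (iZ (- (2 * a)) icos) (iZ (- (2 * b)) isin)).
Qed.

Let icst c : P.-integrable setT (EFin \o (fun _ : Omega => c)).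
Proof. exact: (@bounded_integrable _ `|c|). Qed.

Let int_gi : P.-integrable setT (EFin \o g).
Proof.
by apply: eq_integrable (integrableD measurableT (icst (1 + (a ^+ 2 + b ^+ 2))) ilin)
  => // w _; rewrite /= gE.
Qed.

Let int_g : \int[P]_w g w = 1 - (a ^+ 2 + b ^+ 2).
Proof.
under eq_Rintegral do rewrite gE.
rewrite RintegralD ?Rintegral_prob_cst //.
rewrite RintegralD //; [|exact: iZ icos|exact: iZ isin].
rewrite !RintegralZl // -/a -/b.
by ring.
Qed.

Lemma charfun_sqr_le1 : a ^+ 2 + b ^+ 2 <= 1.
Proof.
by rewrite -subr_ge0 -int_g; apply: Rintegral_ge0 => w _; rewrite addr_ge0 // sqr_ge0.
Qed.

(** If the variance of exp(i theta) vanishes, cosine and sine of theta almost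
    surely equal those of a sample value theta(w0). *)
Lemma charfun_sqr_eq1 : a ^+ 2 + b ^+ 2 = 1 <->
  exists c, \forall w \ae P, exists k : int, theta w = c + 2 * pi * k%:~R.
Proof.
split=> [ab1|[c thetaE]].
  have g0 : \forall w \ae P, g w = 0.
    apply: Rintegral_ge0_eq0 => [|w|]; last by rewrite int_g ab1 subrr.
      exact: int_gi.
    by rewrite addr_ge0 ?sqr_ge0.
  have cs0 : \forall w \ae P, cos (theta w) = a /\ sin (theta w) = b.
    apply: filterS g0 => w /eqP; rewrite paddr_eq0 ?sqr_ge0 // !sqrf_eq0 !subr_eq0.
    by move=> /andP[/eqP -> /eqP ->].
  have [w0 [c0 s0]] := prob_ae_ex cs0.
  exists (theta w0); apply: filterS cs0 => w [cw sw].
  have [|k kE] := @cos_eq1 (theta w - theta w0).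
    by rewrite cosB c0 s0 cw sw -!expr2.
  by exists k; rewrite -kE addrC subrK.
have aE : a = cos c.
  apply: Rintegral_ae_cst => //; apply: filterS thetaE => w [k ->].
  by rewrite cosD; have [-> ->] := cos_sin_2pi k; rewrite mulr1 mulr0 subr0.
have bE : b = sin c.
  apply: Rintegral_ae_cst => //; apply: filterS thetaE => w [k ->].
  by rewrite sinD; have [-> ->] := cos_sin_2pi k; rewrite mulr1 mulr0 addr0.
by rewrite aE bE cos2Dsin2.
Qed.

End characteristic_function.

(** * The inner product *)

Section inner_product.
Context {R : realType}.

Lemma dotvE d (u v : 'cV[R]_d) : dotv u v = (u^T *m v) 0 0.
Proof. by rewrite mxE; apply: eq_bigr => i _; rewrite mxE. Qed.

Lemma dotvC d (u v : 'cV[R]_d) : dotv u v = dotv v u.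
Proof. by apply: eq_bigr => i _; rewrite mulrC. Qed.

Lemma dotvZl d a (u v : 'cV[R]_d) : dotv (a *: u) v = a * dotv u v.
Proof. by rewrite /dotv mulr_sumr; apply: eq_bigr => i _; rewrite mxE mulrA. Qed.

Lemma dot0v d (v : 'cV[R]_d) : dotv 0 v = 0.
Proof. by rewrite -(scale0r 0) dotvZl mul0r. Qed.

Lemma dotvBl d (u v w : 'cV[R]_d) : dotv (u - v) w = dotv u w - dotv v w.
Proof. by rewrite dotvDl dotvNl. Qed.

Lemma dotv_mulmx d n (T : 'M[R]_(d, n)) u v : dotv u (T *m v) = dotv (T^T *m u) v.
Proof. by rewrite !dotvE trmx_mul trmxK mulmxA. Qed.

Lemma dotv_delta d i (v : 'cV[R]_d) : dotv (delta_mx i 0) v = v i 0.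
Proof. by rewrite dotvE trmx_delta -rowE mxE. Qed.

Lemma dotv_col_mx m n (a : 'cV[R]_m) (b : 'cV[R]_n) c e :
  dotv (col_mx a b) (col_mx c e) = dotv a c + dotv b e.
Proof. by rewrite !dotvE tr_col_mx mul_row_col mxE. Qed.

End inner_product.

(** * Frequencies of a random vector *)

Section frequencies.
Context {disp : measure_display} {Omega : measurableType disp} {R : realType}.
Context (P : probability Omega R).

Lemma ae_prob1 (A : set Omega) : measurable A -> P A = 1%E <-> \forall w \ae P, A w.
Proof.
move=> mA; have mAC : measurable (~` A) by exact: measurableC.
have E := probability_setC P mA.
split=> [PA|/(negligibleP P mAC) PA].
  by apply/(negligibleP P mAC); apply: (etrans E); rewrite PA subee.
have {E} : 0%E = (1 - P A)%E := etrans (esym PA) E.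
rewrite -(fineK (fin_num_measure P A mA)) -EFinB => -[/esym/eqP].
by rewrite subr_eq0 => /eqP <-.
Qed.

(** A countable union of level sets. *)
Lemma measurable_int_event (f : Omega -> R) (c : R) : measurable_fun setT f ->
  measurable [set w | f w - c \is a Num.int].
Proof.
move=> mf; have -> : [set w | f w - c \is a Num.int] =
    \bigcup_(k : int) (f @^-1` [set c + k%:~R]).
  apply/seteqP; split=> w /=.
    by move=> /intrP[k kE]; exists k => //=; rewrite -kE addrC subrK.
  by move=> [k _ /= ->]; rewrite addrAC subrr add0r intr_int.
apply: countable_bigcupT_measurable => // k.
by rewrite -[_ @^-1` _]setTI; apply: mf.
Qed.

Context (d : nat) (X : Omega -> 'cV[R]_d).
Context (mX : forall i, measurable_fun setT (fun w => X w i 0)).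

Lemma measurable_dotv u : measurable_fun setT (fun w => dotv u (X w)).
Proof.
apply: measurable_sum => i; apply: measurable_funM => //; exact: measurable_cst.
Qed.

(** By [charfun_modulus] these are the u with |phi(2 pi u)| = 1; the present form
    makes the group structure visible. *)
Definition frequency : set 'cV[R]_d :=
  [set u | exists c, \forall w \ae P, dotv u (X w) - c \is a Num.int].

Lemma charfun_modulus u : `|charfun P X ((2 * pi) *: u)| <= 1 /\
  (`|charfun P X ((2 * pi) *: u)| = 1 <-> frequency u).
Proof.
pose theta w := 2 * pi * dotv u (X w).
have mtheta : measurable_fun setT theta.
  by apply: measurable_funM => //; exact: measurable_dotv.
have pi20 : 2 * pi != 0 :> R by rewrite mulf_neq0 // gt_eqF // pi_gt0.
rewrite normc_def /=.
have -> : (fun w => cos (dotv ((2 * pi) *: u) (X w))) = (fun w => cos (theta w)).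
  by apply/funext => w; rewrite dotvZl.
have -> : (fun w => sin (dotv ((2 * pi) *: u) (X w))) = (fun w => sin (theta w)).
  by apply/funext => w; rewrite dotvZl.
set s := (_ + _ : R); have s1 : s <= 1 := charfun_sqr_le1 P mtheta.
have s0 : 0 <= s by rewrite addr_ge0 ?sqr_ge0.
split; first by rewrite -[1]/(1%:C)%C lecR -sqrtr1 ler_sqrt.
have -> : (Num.sqrt s)%:C%C = 1 <-> s = 1.
  split=> [[] /(congr1 (fun x => x ^+ 2))|->]; last by rewrite sqrtr1.
  by rewrite sqr_sqrtr // expr1n.
rewrite (charfun_sqr_eq1 P mtheta); split=> -[c thetaE].
  exists (c / (2 * pi)); apply: filterS thetaE => w [k kE].
  suff -> : dotv u (X w) = c / (2 * pi) + k%:~R by rewrite addrAC subrr add0r intr_int.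
  by apply: (mulfI pi20); rewrite [RHS]mulrDr [X in X + _]mulrCA mulfV // mulr1 -kE.
exists (2 * pi * c); apply: filterS thetaE => w /intrP[k kE].
by exists k; rewrite -mulrDr -kE addrC subrK.
Qed.

Lemma frequency_subgroup : subgroup_set frequency.
Proof.
split=> [|u v [a ua] [b vb]].
  by exists 0; apply: nearW => w; rewrite dot0v subrr rpred0.
exists (a - b); apply: filterS2 ua vb => w ua vb.
rewrite dotvBl (_ : _ - _ - (a - b) = (dotv u (X w) - a) - (dotv v (X w) - b)); last by ring.
exact: rpredB.
Qed.

Context (hX : nondegenerate_rv P X).

(** Otherwise X would be concentrated on a translate of the hyperplane
    orthogonal to u. *)
Lemma nondegenerate_dotv u c : (\forall w \ae P, dotv u (X w) = c) -> u = 0.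
Proof.
move=> uX; apply: contrapT => /eqP u0.
have uu : dotv u u != 0 by apply: contra u0 => /eqP/dotv_eq0 ->.
pose f : 'Hom('cV[R]_d, 'cV[R]_1) := linfun (mulmx u^T).
have fE x : f x = (dotv u x)%:M by rewrite lfunE /= [LHS]mx11_scalar dotvE.
pose W := lker f.
have WE x : (x \in W) = (dotv u x == 0).
  by rewrite memv_ker fE; apply/eqP/eqP => [/matrixP/(_ 0 0)|->]; rewrite ?raddf0 // !mxE eqxx.
have dimW : (\dim W).+1 = d.
  have dimg : \dim (limg f) = 1%N.
    apply/eqP; rewrite eqn_leq dim_cV lt0n dimv_eq0; apply: contra uu => /eqP f0.
    have := memv_img f (memvf u); rewrite f0 memv0 fE => /eqP/matrixP/(_ 0 0).
    by rewrite !mxE eqxx => /eqP.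
  have := limg_ker_dim f fullv; rewrite capfv dimg dimvf /dim /= muln1 addn1.
  exact.
apply: (hX (a := (c / dotv u u) *: u) dimW); rewrite /concentrated_on.
set A := _ @^-1` _; have -> : A = [set w | dotv u (X w) = c].
  apply/seteqP; split=> w /= => [[y yW <-]|uXc].
    rewrite dotvC dotvDl dotvZl divfK // dotvC.
    by have /eqP -> : dotv u y == 0; rewrite -?WE // addr0.
  exists (X w - (c / dotv u u) *: u); last by rewrite addrC subrK.
  by rewrite /= WE dotvC dotvBl dotvZl divfK // dotvC uXc subrr.
apply/ae_prob1 => //; rewrite -[X in measurable X]setTI.
exact: (measurable_dotv u measurableT (measurable_set1 c)).
Qed.

(** Let S n be the space of affine functions y0 + <u, x> which vanish almost
    surely on {|X| <= n}. These spaces decrease, and their intersection is zero by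
    nondegeneracy, so that S N = 0 for some N. If u is a frequency so small that
    |<u, X>| < 1/2 on {|X| <= N}, then <u, X> cannot jump between different points
    of its coset of Z there; it is almost surely constant on this set, which gives
    an element of S N and hence u = 0. *)
Lemma frequency_separated : separated_set frequency.
Proof.
pose E (n : nat) w := forall i, `|X w i 0| <= n%:R.
pose S n : set 'cV[R]_(1 + d) :=
  [set y | \forall w \ae P, E n w -> dotv y (col_mx 1%:M (X w)) = 0].
have [| | | |N SN] := @decreasing_submod R _ S.
- by move=> n; apply: nearW => w _; rewrite dot0v.
- move=> n a x y; apply: filterS2 => w Ex Ey Ew.
  by rewrite dotvDl dotvZl Ex // Ey // mulr0 addr0.
- move=> n x; apply: filterS => w Ex Ew; apply: Ex => i.
  by apply: le_trans (Ew i) _; rewrite ler_nat.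
- move=> y /ae_foralln Sy.
  have yX : \forall w \ae P, dotv y (col_mx 1%:M (X w)) = 0.
    apply: filterS Sy => w /(_ (Num.truncn (\sum_i `|X w i 0|)).+1); apply => i.
    apply: le_trans (ltW (truncnS_gt _)).
    by rewrite (bigD1 i) //= lerDl sumr_ge0.
  move: yX; rewrite -[y]vsubmxK; set c := usubmx y; set u := dsubmx y => yX.
  have cuX w : dotv (col_mx c u) (col_mx 1%:M (X w)) = c 0 0 + dotv u (X w).
    by rewrite dotv_col_mx dotvE mulmx1 mxE.
  have u0 : u = 0.
    apply: (@nondegenerate_dotv u (- c 0 0)); apply: filterS yX => w.
    by rewrite cuX addrC => /eqP; rewrite addr_eq0 => /eqP.
  have [w] := prob_ae_ex yX; rewrite cuX u0 dot0v addr0 => c0.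
  by rewrite [c]mx11_scalar c0 raddf0 col_mx0.
have K0 : 0 < (2 * (d * N).+1)%:R :> R by rewrite ltr0n.
(* The constant is chosen so that d N / K < 1 / 2; the successor covers d N = 0. *)
exists (2 * (d * N).+1)%:R^-1; first by rewrite invr_gt0.
move=> u [c uX] ue.
have small w : E N w -> `|dotv u (X w)| < 1 / 2.
  move=> Ew; apply: le_lt_trans (ler_norm_sum _ _ _) _.
  apply: le_lt_trans (_ : \sum_(i < d) (2 * (d * N).+1)%:R^-1 * N%:R < _).
    by apply: ler_sum => i _; rewrite normrM ler_pM // ltW.
  rewrite sumr_const card_ord -[_ *+ d]mulr_natr -mulrA -natrM [(N * d)%N]mulnC mulrC ltr_pdivrMr //.
  by rewrite div1r (natrM _ 2) mulKf // ltr_nat.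
have {}uX : exists c', \forall w \ae P, E N w -> dotv u (X w) = c'.
  have [[w0 [Ew0 uw0]]|no] := pselect (exists w0, E N w0 /\ dotv u (X w0) - c \is a Num.int).
    exists (dotv u (X w0)); apply: filterS uX => w uw Ew.
    have : dotv u (X w) - dotv u (X w0) \is a Num.int.
      rewrite (_ : _ - _ = (dotv u (X w) - c) - (dotv u (X w0) - c)); last by ring.
      exact: rpredB.
    have := small _ Ew; have := small _ Ew0; rewrite !ltr_norml.
    move: (dotv _ _) (dotv _ _) => x y /andP[x1 x2] /andP[y1 y2] /intrP[k kE].
    have : `|x - y| < 1 by rewrite ltr_norml; apply/andP; split; lra.
    rewrite kE -intr_norm -[1]/(1%:~R) ltr_int -[1]add0r ltzD1 normr_le0 => /eqP k0.
    by apply/eqP; rewrite -subr_eq0 kE k0.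
  (* Here {|X| <= N} is a null set and any constant will do. *)
  exists 0; apply: filterS uX => w uw Ew; case: no; by exists w.
have [c' uc'] := uX.
have /SN : S N (col_mx (- c')%:M u).
  apply: filterS uc' => w uE Ew.
  by rewrite dotv_col_mx uE // dotvE mulmx1 mxE mxE eqxx mulr1n addNr.
by move=> /(congr1 dsubmx); rewrite col_mxKd => ->; rewrite raddf0.
Qed.

End frequencies.

(** Coordinates are continuous, and the Borel sigma-algebra on R^d is generated
    by the open sets. *)
Lemma measurable_coord disp (Omega : measurableType disp) (R : realType)
    (P : probability Omega R) d (X : {RV P >-> borelRd R d}) i :
  measurable_fun setT (fun w => (X w : 'cV[R]_d) i 0).
Proof.
have mi : measurable_fun setT (fun x : borelRd R d => (x : 'cV[R]_d) i 0).
  apply: (measurability _ (RGenOpens.measurableE R)) => _ [_ [a [b ->] <-]].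
  rewrite setTI; apply: sub_sigma_algebra.
  have /continuousP : continuous (fun x : 'cV[R]_d => x i 0) by exact: coord_continuous.
  apply; exact: interval_open.
exact: (measurableT_comp mi).
Qed.

(** * Integral bases in coordinates, and orthogonal projections *)

Section padding.
Context {R : realType}.

(** The inclusion of R^r in R^d = R^r x R^(d - r); its transpose is the
    projection [head_part]. *)
Definition pad d r (hr : (r <= d)%N) : 'M[R]_(d, r) :=
  \matrix_(i, j) (i == widen_ord hr j)%:R.

Lemma tr_pad_mul d r n (hr : (r <= d)%N) (T : 'M[R]_(d, n)) :
  (pad hr)^T *m T = rowsub (widen_ord hr) T.
Proof.
apply/matrixP => i j; rewrite !mxE (bigD1 (widen_ord hr i)) //= big1 ?addr0.
  by rewrite !mxE eqxx mul1r.
by move=> k /negPf ki; rewrite !mxE ki mul0r.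
Qed.

Lemma tr_padK d r (hr : (r <= d)%N) : (pad hr)^T *m pad hr = 1%:M.
Proof.
rewrite tr_pad_mul; apply/matrixP => i j; rewrite !mxE -!val_eqE /=.
by rewrite val_eqE.
Qed.

Lemma pad_zero d r (hr : (r <= d)%N) (u : 'cV[R]_d) :
  (forall i : 'I_d, (r <= i)%N -> u i 0 = 0) <-> u = pad hr *m ((pad hr)^T *m u).
Proof.
split=> [u0|-> i ri].
  apply/colP => i; rewrite tr_pad_mul [RHS]mxE; case: (ltnP i r) => [ir|ri].
    rewrite (bigD1 (Ordinal ir)) //= big1 ?addr0.
      rewrite !mxE; have -> : widen_ord hr (Ordinal ir) = i by exact: val_inj.
      by rewrite eqxx mul1r.
    move=> k kr; rewrite !mxE; case: eqP => [ik|]; last by rewrite mul0r.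
    by case/eqP: kr; apply: val_inj; rewrite /= ik.
  rewrite u0 // big1 // => k _; rewrite !mxE; case: eqP => [ik|]; last by rewrite mul0r.
  by move: ri; rewrite ik /= leqNgt ltn_ord.
rewrite mxE big1 // => k _; rewrite mxE; case: eqP => [ik|]; last by rewrite mul0r.
by move: ri; rewrite ik /= leqNgt ltn_ord.
Qed.

Lemma ZvecP r (x : 'cV[R]_r) : Zvec x <-> exists m : 'cV[int]_r, x = map_mx intr m.
Proof.
split=> [xZ|[m -> i]]; last by rewrite mxE intr_int.
exists (\col_i Num.floor (x i 0)); apply/colP => i; rewrite !mxE.
by rewrite floorK.
Qed.

Lemma head_partE d r (hr : (r <= d)%N) (u : 'cV[R]_d) : head_part hr u = (pad hr)^T *m u.
Proof. by rewrite tr_pad_mul. Qed.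

Lemma Zvec0P d r (hr : (r <= d)%N) (u : 'cV[R]_d) :
  Zvec0 hr u <-> exists m : 'cV[int]_r, u = pad hr *m map_mx intr m.
Proof.
rewrite /Zvec0 /= head_partE; split=> [[/ZvecP[m mE] /pad_zero ->]|[m ->]].
  by exists m; rewrite mE.
rewrite mulmxA tr_padK mul1mx; split; first by apply/ZvecP; exists m.
by apply/pad_zero; rewrite (mulmxA (pad hr)^T) tr_padK mul1mx.
Qed.

Lemma colfree_mul d n k (A : 'M[R]_(d, n)) (B : 'M[R]_(n, k)) :
  colfree A -> colfree B -> colfree (A *m B).
Proof. by move=> Afree Bfree y; rewrite -mulmxA => /Afree/Bfree. Qed.

Lemma colfree_pad d r (hr : (r <= d)%N) : colfree (pad hr).
Proof. by move=> y /(congr1 (mulmx (pad hr)^T)); rewrite mulmxA tr_padK mul1mx mulmx0. Qed.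

Lemma colfree_unit n (T : 'M[R]_n) : T \in unitmx -> colfree T.
Proof. by move=> Tu y /(congr1 (mulmx (invmx T))); rewrite mulKmx // mulmx0. Qed.

Lemma zbasis_unimodular d n (G : set 'cV[R]_d) (B : 'M[R]_(d, n)) (U : 'M[int]_n) :
  U \in unitmx -> zbasis G B -> zbasis G (B *m map_mx intr U).
Proof.
move=> Uu [Bfree GB]; split.
  apply: colfree_mul => // y.
  move=> /(congr1 (mulmx (map_mx intr (invmx U)))); rewrite mulmxA -map_mxM mulVmx //.
  by rewrite map_mx1 mul1mx mulmx0.
move=> u; rewrite GB; split=> [[m ->]|[m ->]].
  by exists (invmx U *m m); rewrite -mulmxA -map_mxM mulKVmx.
by exists (U *m m); rewrite -mulmxA -map_mxM.
Qed.

Lemma zbasis_colspan_uniq d n k (G : set 'cV[R]_d) (B : 'M[R]_(d, n)) (C : 'M[R]_(d, k)) :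
  zbasis G B -> zbasis G C -> colspan B = colspan C.
Proof.
move=> GB GC; apply: subv_anti; apply/andP; split.
  by apply/(zbasis_sub _ GB); apply/(zbasis_sub _ GC).
by apply/(zbasis_sub _ GC); apply/(zbasis_sub _ GB).
Qed.

Lemma zbasis_size d n k (G : set 'cV[R]_d) (B : 'M[R]_(d, n)) (C : 'M[R]_(d, k)) :
  zbasis G B -> zbasis G C -> n = k.
Proof.
by move=> GB GC; rewrite -(dim_colspan GB.1) (zbasis_colspan_uniq GB GC) dim_colspan //; case: GC.
Qed.

(** A bounded linear map sends small vectors to small vectors, and the only small
    integer vector is zero. *)
Lemma int_coord_separated d n (G : set 'cV[R]_d) (A : 'M[R]_(n, d)) :
  (forall x, G x -> Zvec (A *m x)) -> (forall x, G x -> A *m x = 0 -> x = 0) ->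
  separated_set G.
Proof.
move=> GZ Ginj; pose C : R := \sum_k \sum_j `|A k j|.
have C0 : 0 <= C by apply: sumr_ge0 => k _; exact: sumr_ge0.
have C1 : 0 < C + 1 by rewrite ltr_wpDl.
exists (C + 1)^-1; first by rewrite invr_gt0.
move=> x Gx xs; apply: Ginj => //; apply/colP => i; rewrite [RHS]mxE.
have /intrP[k kE] := GZ _ Gx i.
have : `|(A *m ((C + 1) *: x)) i 0| <= C.
  apply: mulmx_bound => j; rewrite mxE normrM gtr0_norm //.
  by rewrite mulrC -ler_pdivlMr // div1r ltW.
rewrite -scalemxAr mxE kE normrM gtr0_norm // -intr_norm => kC.
have : `|k|%:~R < 1%:~R :> R.
  rewrite -(ltr_pM2l C1) mulr1; apply: le_lt_trans kC _; by rewrite ltrDl.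
by rewrite ltr_int -[1]add0r ltzD1 normr_le0 => /eqP ->.
Qed.

Lemma orthoproj_in d (V : {vspace 'cV[R]_d}) x : orthoproj V x \in V.
Proof. by case: (orthoprojP V x). Qed.

Lemma dotv_orthoproj d (V : {vspace 'cV[R]_d}) x v :
  v \in V -> dotv v (orthoproj V x) = dotv v x.
Proof.
case: (orthoprojP V x) => _ /[apply] /eqP.
by rewrite dotvBl subr_eq0 !(dotvC _ v) => /eqP.
Qed.

Lemma orthoproj_adjoint d (V : {vspace 'cV[R]_d}) u x :
  dotv u (orthoproj V x) = dotv (orthoproj V u) x.
Proof.
rewrite -(dotv_orthoproj x (orthoproj_in V u)) dotvC.
by rewrite -(dotv_orthoproj u (orthoproj_in V x)) dotvC.
Qed.

Lemma dotv_col d n (B : 'M[R]_(d, n)) j x : dotv (col j B) x = (B^T *m x) j 0.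
Proof. by rewrite dotvE tr_col -row_mul mxE. Qed.

End padding.

(** * Arithmetic of canonical shifts *)

Section shift_arithmetic.
Context {R : realType}.

(** Multiplying N <m, beta> by q clears the rational entries of beta, which leaves an
    integral relation between the rationally independent ones. *)
Lemma canonical_shift_tail r nu q (beta : 'cV[R]_r) (m : 'cV[int]_r) (N : nat) :
  canonical_shift nu q beta -> (0 < N)%N ->
  N%:R * dotv (map_mx intr m) beta \is a Num.int ->
  forall i : 'I_r, (nu <= i)%N -> m i 0 = 0.
Proof.
move=> [p [[pq cpq q1 beta0 betanu] [_ _ indep]]] N0 Nm i nui.
have q0 : (0 < q)%N := leq_ltn_trans (leq0n p) pq.
pose c (j : {i : 'I_r | (nu < i.+1)%N}) : int := (q * N)%N%:Z * m (val j) 0.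
have hi : (nu < i.+1)%N by [].
suff /indep/(_ (exist _ i hi)) : \sum_j (c j)%:~R * beta (val j) 0 \is a Num.int.
  move=> /eqP; rewrite /c mulf_eq0 /= => /orP[|/eqP //].
  by rewrite -[_ == _]/((q * N)%N == 0%N) muln_eq0 !gtn_eqF.
have -> : \sum_j (c j)%:~R * beta (val j) 0 =
    \sum_(j : 'I_r | (nu < j.+1)%N) (q * N)%:R * ((m j 0)%:~R * beta j 0).
  rewrite (big_sub [pred j : 'I_r | (nu < j.+1)%N]
    (fun j => (q * N)%:R * ((m j 0)%:~R * beta j 0))).
  by apply: eq_bigr => j _; rewrite /c intrM mulrA.
have -> : \sum_(j : 'I_r | (nu < j.+1)%N) (q * N)%:R * ((m j 0)%:~R * beta j 0) =
    q%:R * (N%:R * dotv (map_mx intr m) beta) -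
    \sum_(j : 'I_r | ~~ (nu < j.+1)%N) (q * N)%:R * ((m j 0)%:~R * beta j 0).
  rewrite mulrA -natrM.
  have -> : (q * N)%:R * dotv (map_mx intr m) beta = \sum_j (q * N)%:R * ((m j 0)%:~R * beta j 0).
    by rewrite mulr_sumr; apply: eq_bigr => j _; rewrite mxE.
  by rewrite [X in X - _](bigID [pred j : 'I_r | (nu < j.+1)%N]) addrK.
rewrite rpredB //; first by rewrite rpredM // natr_int.
apply: rpred_sum => j; rewrite -leqNgt leq_eqVlt => /orP[/eqP jnu|jnu].
  rewrite betanu // natrM [q%:R * _]mulrC -mulrA rpredM ?natr_int //.
  rewrite mulrCA rpredM ?intr_int // mulrC divfK ?natr_int //.
  by rewrite pnatr_eq0 gtn_eqF.
by rewrite beta0 // !mulr0 rpred0.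
Qed.

Lemma canonical_shift_head r nu q (beta : 'cV[R]_r) (m : 'cV[int]_r) :
  canonical_shift nu q beta -> (forall i : 'I_r, (nu <= i)%N -> m i 0 = 0) ->
  q%:R * dotv (map_mx intr m) beta \is a Num.int.
Proof.
move=> [p [[pq cpq q1 beta0 betanu] _]] m0.
have q0 : (0 < q)%N := leq_ltn_trans (leq0n p) pq.
rewrite mulr_sumr; apply: rpred_sum => j _; rewrite mxE.
case: (ltngtP j.+1 nu) => jnu.
- by rewrite beta0 // !mulr0 rpred0.
- by rewrite m0 // mul0r mulr0 rpred0.
- rewrite betanu // mulrCA rpredM ?intr_int // mulrC divfK ?natr_int //.
  by rewrite pnatr_eq0 gtn_eqF.
Qed.

(** The test vector is the basis vector at position nu, where N p / q has to be
    an integer. *)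
Lemma canonical_shift_dvd r nu q (beta : 'cV[R]_r) (N : nat) : (nu <= r)%N ->
  canonical_shift nu q beta ->
  (forall m : 'cV[int]_r, (forall i : 'I_r, (nu <= i)%N -> m i 0 = 0) ->
     N%:R * dotv (map_mx intr m) beta \is a Num.int) ->
  (q %| N)%N.
Proof.
move=> nur [p [[pq cpq q1 beta0 betanu] _]] mN.
have q0 : (0 < q)%N := leq_ltn_trans (leq0n p) pq.
case: (posnP nu) => [/q1 ->|nu0]; first exact: dvd1n.
have ir : (nu.-1 < r)%N by rewrite prednK.
pose i := Ordinal ir; have inu : i.+1 = nu by rewrite /= prednK.
have /mN : forall j : 'I_r, (nu <= j)%N -> (delta_mx i 0 : 'cV[int]_r) j 0 = 0.
  move=> j nuj; rewrite mxE; case: eqP => [ji|//].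
  by move: nuj; rewrite ji -inu ltnn.
rewrite map_delta_mx dotv_delta betanu // => /intrP[k].
have qR : q%:R != 0 :> R by rewrite pnatr_eq0 gtn_eqF.
move=> /(congr1 (fun x => x * q%:R)); rewrite mulrA divfK // -natrM => E.
have {}E : (N * p)%:Z = k * q%:Z by apply: (@intr_inj R); rewrite intrM -!pmulrn.
have : (q %| N * p)%N.
  by apply/dvdnP; exists `|k|%N; rewrite -[q]/(`|q%:Z|%N) -abszM -E.
by rewrite Gauss_dvdl // coprime_sym.
Qed.

End shift_arithmetic.

(** * Normal forms *)

Section normal_form.
Context {disp : measure_display} {Omega : measurableType disp} {R : realType}.
Context (P : probability Omega R) (d : nat) (X : Omega -> 'cV[R]_d).
Context (mX : forall i, measurable_fun setT (fun w => X w i 0)).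
Context (hX : nondegenerate_rv P X).

Local Notation H := (frequency P X).

Lemma col_subE n (x y : 'cV[R]_n) j : (x - y) j 0 = x j 0 - y j 0.
Proof. by rewrite mxE [X in _ + X]mxE. Qed.

Lemma measurable_forall_ord n (A : 'I_n -> set Omega) :
  (forall i, measurable (A i)) -> measurable [set w | forall i, A i w].
Proof.
move=> mA; have -> : [set w | forall i, A i w] = \bigcap_(i in [set: 'I_n]) A i.
  by apply/seteqP; split=> w /= Aw i //; exact: Aw.
by apply: fin_bigcap_measurable => //; exact: finite_finset.
Qed.

(** The unit modulus condition is a statement about H: as phi_TX(u) = phi_X(T^T u), it
    asserts that the first r rows of T are an integral basis of H. *)
Lemma unit_modulus_zbasis (T : 'M[R]_d) r (hr : (r <= d)%N) : T \in unitmx ->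
  unit_modulus_on_Zvec0 P X T hr <-> zbasis H (T^T *m pad hr).
Proof.
move=> Tu; have TTu : T^T \in unitmx by rewrite unitmx_tr.
have charT u : charfun P (fun w => T *m X w) ((2 * pi) *: u) = charfun P X ((2 * pi) *: (T^T *m u)).
  have E w : dotv ((2 * pi) *: u) (T *m X w) = dotv ((2 * pi) *: (T^T *m u)) (X w).
    by rewrite dotv_mulmx scalemxAr.
  rewrite /charfun; under eq_Rintegral do rewrite E.
  by under [in X in (_ +i* X)%C]eq_Rintegral do rewrite E.
have HE u : `|charfun P (fun w => T *m X w) ((2 * pi) *: u)| = 1 <-> H (T^T *m u).
  by rewrite charT; case: (charfun_modulus P mX (T^T *m u)).
split=> [um|[_ HT] u].
  split; first by apply: colfree_mul (colfree_unit TTu) (@colfree_pad _ _ _ hr).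
  move=> u; rewrite -{1}[u](mulKVmx TTu) -HE um Zvec0P; split=> -[m mE]; exists m.
    by rewrite -mulmxA -mE mulKVmx.
  by rewrite mE -mulmxA mulKmx.
rewrite HE HT Zvec0P; split=> -[m mE]; exists m.
  by apply: (can_inj (mulKmx TTu)); rewrite mE mulmxA.
by rewrite mE mulmxA.
Qed.

(** Applied to two events, membership of Y in a coset of Z^r and membership of
    the projection of X in a coset of a lattice: both only restrict the inner
    products with the columns of B. *)
Lemma concentrated_coset n (B : 'M[R]_(d, n)) (A : set 'cV[R]_d) (beta : 'cV[R]_n) :
  (forall x, A x <-> Zvec (B^T *m x - beta)) ->
  P (X @^-1` A) = 1%E <-> \forall w \ae P, Zvec (B^T *m X w - beta).
Proof.
move=> AE; have -> : X @^-1` A = [set w | forall j, dotv (col j B) (X w) - beta j 0 \is a Num.int].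
  apply/seteqP; split=> w /=.
    by move=> /AE AX j; have := AX j; rewrite col_subE dotv_col.
  by move=> AX; apply/AE => j; rewrite col_subE -dotv_col.
rewrite ae_prob1.
  split; apply: filterS => w AX j; have := AX j; by rewrite col_subE dotv_col.
apply: measurable_forall_ord => j; apply: measurable_int_event; exact: measurable_dotv.
Qed.

Lemma head_part_concentrated (T : 'M[R]_d) r (hr : (r <= d)%N) (beta : 'cV[R]_r) :
  concentrated_on P (fun w => head_part hr (T *m X w)) [set beta + m | m in @Zvec R r] <->
  \forall w \ae P, Zvec ((T^T *m pad hr)^T *m X w - beta).
Proof.
apply: (@concentrated_coset _ _ [set x | [set beta + m | m in @Zvec R r] (head_part hr (T *m x))]) => x /=.
rewrite trmx_mul trmxK -mulmxA head_partE; split=> [[m mZ <-]|xZ].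
  by rewrite addrAC subrr add0r.
by eexists; [exact: xZ|rewrite addrC subrK].
Qed.

Lemma frequency_coset n (B : 'M[R]_(d, n)) : zbasis H B ->
  exists beta : 'cV[R]_n, \forall w \ae P, Zvec (B^T *m X w - beta).
Proof.
move=> [_ HB].
have /choice[c cE] (j : 'I_n) : exists c, \forall w \ae P, dotv (col j B) (X w) - c \is a Num.int.
  by apply/HB; exists (delta_mx j 0); rewrite map_delta_mx colE.
exists (\col_j c j).
have : \forall w \ae P, forall j, j \in enum 'I_n -> dotv (col j B) (X w) - c j \is a Num.int.
  elim: (enum _) => [|j s IH]; first by apply: nearW.
  apply: filterS2 (cE j) IH => w cj IH k; rewrite inE => /predU1P[->//|]; exact: IH.
apply: filterS => w wE j; have := wE j; rewrite mem_enum => /(_ isT).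
by rewrite dotv_col col_subE (_ : (\col_j c j) j 0 = c j) // mxE.
Qed.

(** If C is a left inverse of B, the projections of the rows of C to the span V
    of B are the basis D of V dual to B, and the projection to V is D B^T.
    As B^T X lies in a coset of Z^n, the projection of X lies in a coset of the
    lattice generated by D. *)
Lemma lattice_part_frequency n (B : 'M[R]_(d, n)) : zbasis H B -> lattice_part P X (colspan B).
Proof.
move=> HB; have HBspan := (zbasis_sub (colspan B) HB).1 (subvv _).
split; last first.
  move=> v vB; have [le1 eq1] := charfun_modulus P mX v.
  rewrite lt_neqAle le1 andbT; apply: contra vB => /eqP/eq1; exact: HBspan.
have [C CB] : exists C : 'M[R]_(n, d), C *m B = 1%:M.
  have /row_freeP[C CE] := colfree_row_free HB.1.
  by exists C^T; apply: trmx_inj; rewrite trmx_mul trmxK CE trmx1.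
pose D : 'M[R]_(d, n) := \matrix_(i, j) orthoproj (colspan B) (col j C^T) i 0.
have colD j : col j D = orthoproj (colspan B) (col j C^T).
  by apply/colP => i; rewrite !mxE.
have BD : B^T *m D = 1%:M.
  apply/matrixP => i j; have -> : (B^T *m D) i j = dotv (col i B) (col j D).
    by rewrite dotv_col [col j D]colE mulmxA -colE [RHS]mxE.
  rewrite colD dotv_orthoproj ?col_colspan // dotvC dotv_col trmxK.
  by rewrite colE mulmxA CB mul1mx !mxE eqxx andbT eq_sym.
have projE x : orthoproj (colspan B) x = D *m (B^T *m x).
  apply: orthoproj_unique (orthoprojP _ x) _; split.
    have /subvP : (colspan D <= colspan B)%VS.
      by apply: colspan_sub => j; rewrite colD orthoproj_in.
    by apply; apply/colspanP; exists (B^T *m x).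
  move=> _ /colspanP[z ->].
  by rewrite dotv_mulmx mulmxBr (mulmxA B^T) BD mul1mx subrr dot0v.
have [beta betaE] := frequency_coset HB.
pose G := [set D *m m | m in @Zvec R n].
have BG x : G x -> Zvec (B^T *m x) by move=> [m mZ <-]; rewrite mulmxA BD mul1mx.
exists (D *m beta), G; split.
  apply: separated_is_lattice; last first.
    apply: (int_coord_separated BG) => _ [m _ <-].
    by rewrite mulmxA BD mul1mx => ->; rewrite mulmx0.
  split; first by exists 0; [move=> i; rewrite mxE rpred0|rewrite mulmx0].
  move=> _ _ [m mZ <-] [m' mZ' <-]; exists (m - m'); last by rewrite mulmxBr.
  by move=> i; rewrite col_subE rpredB.
apply/(@concentrated_coset _ B [set x | [set D *m beta + g | g in G] (orthoproj (colspan B) x)] beta) => //.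
move=> x /=; rewrite projE; split=> [[g [m mZ <-]]|xZ].
  move=> /(congr1 (mulmx B^T)); rewrite mulmxDr !mulmxA BD !mul1mx => <-.
  by rewrite addrAC subrr add0r.
by exists (D *m (B^T *m x - beta)); [exists (B^T *m x - beta)|rewrite -mulmxDr addrC subrK].
Qed.

(** Let C be an integral basis of the lattice supporting the projection of X to
    V, and D a left inverse of C. The projections to V of the rows of D, which
    are the columns of Q, are frequencies: their inner products with X are the
    integer coordinates D pi_V(X), up to a constant. For z in V, the
    function <z, X> = <z, pi_V(X)> is affine in these coordinates, with linear part
    C^T z; hence <z - Q C^T z, X> is constant and nondegeneracy gives
    z = Q C^T z. *)
Lemma lattice_part_sub (V W : {vspace 'cV[R]_d}) :
  lattice_part P X V -> (forall u, H u -> u \in W) -> (V <= W)%VS.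
Proof.
move=> [[a [G [Glat XG]]] _] HW.
have [sG sepG] := is_lattice_separated Glat.
have [k [C [Cfree GC]]] := subgroup_zbasis sG sepG.
have [D DC] : exists D : 'M[R]_(k, d), D *m C = 1%:M.
  have /row_freeP[D DE] := colfree_row_free Cfree.
  by exists D^T; apply: trmx_inj; rewrite trmx_mul trmxK DE trmx1.
have {XG} XG : \forall w \ae P, exists m : 'cV[int]_k, orthoproj V (X w) = a + C *m map_mx intr m.
  have AE : [set w | exists m : 'cV[int]_k, orthoproj V (X w) = a + C *m map_mx intr m] =
      (fun w => orthoproj V (X w)) @^-1` [set a + g | g in G].
    apply/seteqP; split=> w /= [].
      by move=> m ->; eexists; [apply/GC; exists m|].
    by move=> g /GC[m ->] <-; exists m.
  apply/(@ae_prob1 _ _ _ P [set w | exists m : 'cV[int]_k, orthoproj V (X w) = a + C *m map_mx intr m]).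
    rewrite (_ : mkset _ = \bigcup_(m : 'cV[int]_k)
        [set w | forall i, dotv (orthoproj V (delta_mx i 0)) (X w) = (a + C *m map_mx intr m) i 0]).
      apply: countable_bigcupT_measurable => // m; apply: measurable_forall_ord => i.
      rewrite -[X in measurable X]setTI.
      exact: (measurable_dotv mX _ measurableT (measurable_set1 _)).
    apply/seteqP; split=> w /= [m].
      by move=> Xm; exists m => // i; rewrite -orthoproj_adjoint dotv_delta Xm.
    by move=> _ Xm; exists m; apply/colP => i; rewrite -Xm -orthoproj_adjoint dotv_delta.
  by rewrite AE.
pose Q : 'M[R]_(d, k) := \matrix_(i, j) orthoproj V (col j D^T) i 0.
have QE x : Q^T *m x = D *m orthoproj V x.
  apply/colP => j; rewrite -dotv_col -[D]trmxK -dotv_col orthoproj_adjoint.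
  by congr dotv; apply/colP => i; rewrite !mxE.
have /subvP QW : (colspan Q <= W)%VS.
  apply: colspan_sub => j; apply: HW; exists ((D *m a) j 0).
  apply: filterS XG => w [m mE].
  rewrite dotv_col QE mE mulmxDr mulmxA DC mul1mx mxE addrAC subrr add0r mxE.
  exact: intr_int.
apply/subvP => z zV.
suff /eqP : z - Q *m (C^T *m z) = 0.
  by rewrite subr_eq0 => /eqP ->; apply: QW; apply/colspanP; eexists.
apply: (nondegenerate_dotv mX hX (c := dotv z a - dotv (C^T *m z) (D *m a))).
apply: filterS XG => w [m mE].
rewrite dotvBl -(dotv_orthoproj _ zV) -[Q]trmxK -dotv_mulmx QE mE.
rewrite mulmxDr (mulmxA D) DC mul1mx.
rewrite dotvC dotvDl !(dotvC _ z) dotv_mulmx [X in _ - X]dotvC dotvDl !(dotvC _ (C^T *m z)).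
by rewrite opprD addrACA subrr addr0.
Qed.

(** The frequencies u for which the class of <u, X> in R/Z, which is almost surely
    constant, has finite order. *)
Definition torsion_frequency : set 'cV[R]_d :=
  [set u | H u /\ exists2 N : nat, (0 < N)%N &
    \forall w \ae P, N%:R * dotv u (X w) \is a Num.int].

(** The right-hand sides mention X only, which is what makes V, r, nu and q
    unique. *)
Lemma normal_form_invariants V T nu r q : lattice_normal_form P X V T nu r q ->
  exists (B : 'M[R]_(d, r)) (C : 'M[R]_(d, nu)),
    [/\ zbasis H B, V = colspan B, zbasis torsion_frequency C
      & forall N : nat, (q %| N)%N <-> forall u, torsion_frequency u ->
          \forall w \ae P, N%:R * dotv u (X w) \is a Num.int].
Proof.
move=> [hr [[Tu nur q0] [latV um [beta [shift XT]]]]].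
have HB := (unit_modulus_zbasis hr Tu).1 um.
have {XT} := (head_part_concentrated T hr beta).1 XT.
move: HB; set B := T^T *m pad hr => HB XT.
have dotB (m : 'cV[int]_r) (N : nat) :
    (\forall w \ae P, N%:R * dotv (B *m map_mx intr m) (X w) \is a Num.int) <->
    N%:R * dotv (map_mx intr m) beta \is a Num.int.
  have XE : \forall w \ae P, N%:R * dotv (B *m map_mx intr m) (X w) -
      N%:R * dotv (map_mx intr m) beta \is a Num.int.
    apply: filterS XT => w XT; rewrite -mulrBr rpredM ?natr_int //.
    rewrite -[B]trmxK -dotv_mulmx 2!(dotvC (map_mx intr m)) -dotvBl.
    apply: rpred_sum => i _; rewrite rpredM //; by rewrite mxE intr_int.
  split=> [XB|mbeta].
    have [w [X1 X2]] := prob_ae_ex (filterI XB XE).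
    by rewrite -(rpredBr _ X1) -opprB rpredN.
  by apply: filterS XE => w XE; rewrite -(subrK (N%:R * dotv (map_mx intr m) beta) (N%:R * _)) rpredD.
have torE (m : 'cV[int]_r) : torsion_frequency (B *m map_mx intr m) <->
    forall i : 'I_r, (nu <= i)%N -> m i 0 = 0.
  split=> [[_ [N N0 /dotB]]|m0]; first exact: canonical_shift_tail shift N0.
  split; first by apply/HB.2; exists m.
  by exists q => //; apply/dotB; exact: canonical_shift_head shift m0.
exists B, (B *m pad nur); split=> //.
- apply: subv_anti; rewrite (lattice_part_sub latV ((zbasis_sub _ HB).1 (subvv _))) /=.
  apply/(zbasis_sub _ HB) => u Hu; apply/negPn/negP => uV.
  by have := latV.2 u uV; rewrite (charfun_modulus P mX u).2.2 // ltxx.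
- split; first exact: colfree_mul HB.1 (@colfree_pad _ _ _ nur).
  move=> u; split=> [tu|[m ->]].
    have [m uE] := (HB.2 u).1 tu.1; rewrite uE in tu *.
    have /Zvec0P[m' m'E] : Zvec0 nur (map_mx intr m : 'cV[R]_r).
      split=> [i|i nui]; first by rewrite !mxE intr_int.
      by rewrite mxE (torE m).1.
    by exists m'; rewrite m'E mulmxA.
  rewrite -mulmxA.
  have /Zvec0P[_ m0] : exists m', pad nur *m map_mx intr m = pad nur *m map_mx intr m' :> 'cV[R]_r.
    by exists m.
  have [m' m'E] : exists m' : 'cV[int]_r, pad nur *m map_mx intr m = map_mx intr m' :> 'cV[R]_r.
    apply/ZvecP => i; rewrite mxE; apply: rpred_sum => j _.
    by rewrite rpredM // mxE ?intr_int // natr_int.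
  rewrite m'E; apply/torE => i nui; apply: (@intr_inj R).
  by have := m0 i nui; rewrite m'E mxE => ->.
- move=> N; split=> [/dvdnP[k ->] u tu|tN].
    have [m uE] := (HB.2 u).1 tu.1; rewrite uE in tu *.
    have /dotB := canonical_shift_head shift ((torE m).1 tu).
    by apply: filterS => w qX; rewrite natrM -mulrA rpredM ?natr_int.
  apply: canonical_shift_dvd nur shift _ => m m0.
  by apply/dotB; apply: tN; apply/torE.
Qed.

End normal_form.

Theorem proposition2p1 (disp : measure_display) (Omega : measurableType disp)
  (R : realType) (P : probability Omega R) (d : nat)
  (X : {RV P >-> borelRd R d}) (hX : nondegenerate_rv P X) :
  (exists (V : {vspace 'cV[R]_d}) (T : 'M[R]_d) (nu r q : nat),
      lattice_normal_form P X V T nu r q) /\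
  (forall (V V' : {vspace 'cV[R]_d}) (T T' : 'M[R]_d) (nu nu' r r' q q' : nat),
      lattice_normal_form P X V T nu r q -> lattice_normal_form P X V' T' nu' r' q' ->
      [/\ V = V', r = r', nu = nu' & q = q']) /\
  (forall (V : {vspace 'cV[R]_d}) (T : 'M[R]_d) (nu r q : nat),
      lattice_normal_form P X V T nu r q -> r = \dim V).
Proof.
have mX := measurable_coord X.
split; last split.
- have [r [B0 HB0]] := subgroup_zbasis (frequency_subgroup P X) (frequency_separated mX hX).
  have [beta0 X0] := frequency_coset HB0.
  have [U [n [nu [q [Uu nur q0 shift]]]]] := canonical_shift_exists beta0.
  set beta := _ + _ in shift.
  have HB : zbasis (frequency P X) (B0 *m map_mx intr U^T).
    by apply: zbasis_unimodular HB0; rewrite unitmx_tr.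
  set B := B0 *m _ in HB.
  have hr : (r <= d)%N by rewrite -(dim_colspan HB.1) dim_cV.
  have [T Tu TB] := row_completion hr HB.1.
  have TE : T^T *m pad hr = B by apply: trmx_inj; rewrite trmx_mul trmxK tr_pad_mul.
  exists (colspan B), T, nu, r, q, hr; split=> //; split.
  + exact: lattice_part_frequency.
  + by apply/unit_modulus_zbasis; rewrite ?TE.
  + exists beta; split=> //; apply/head_part_concentrated => //; rewrite TE.
    apply: filterS X0 => w /ZvecP[m mE]; apply/ZvecP; exists (U *m m - n).
    rewrite /B trmx_mul -map_trmx trmxK -mulmxA.
    rewrite -[B0^T *m X w](subrK beta0) mE mulmxDr -map_mxM /beta opprD addrA addrK.
    by rewrite map_mxB.
- move=> V V' T T' nu nu' r r' q q' nf nf'.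
  have [B [C [HB VB tC qE]]] := normal_form_invariants mX hX nf.
  have [B' [C' [HB' VB' tC' qE']]] := normal_form_invariants mX hX nf'.
  split.
  + by rewrite VB VB'; exact: zbasis_colspan_uniq HB HB'.
  + exact: zbasis_size HB HB'.
  + exact: zbasis_size tC tC'.
  + apply/eqP; rewrite eqn_dvd; apply/andP; split.
      by apply/qE; apply/qE'.
    by apply/qE'; apply/qE.
- move=> V T nu r q nf.
  have [B [C [HB -> _ _]]] := normal_form_invariants mX hX nf.
  by rewrite dim_colspan //; case: HB.
Qed.
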